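(* Let $\alpha \in [0,1[$ and let $(u_k)_{k \in \mathbb N}$ be a sequence in $\mathrm{BV}_c^\alpha(\mathbb R^n)$ with $\sup_{k\in \mathbb N} \bigl(\|u_k\|_{L^1} + \mathbf V^\alpha(u_k)\bigr) < \infty$ and $\bigcup_{k \in \mathbb N}\operatorname{spt}(u_k) \subset K$ for some compact $K \subset \mathbb R^n$. Then there exists a subsequence of $(u_k)_{k \in \mathbb N}$ that converges in $L^1$ to some $u \in \mathrm{BV}_c^\alpha(\mathbb R^n)$ with $\mathbf V^\alpha(u) \leq \liminf_{k\to\infty}\mathbf V^\alpha(u_k)$.
   Context: $n\ge1$. $L^1_c(\mathbb R^n)$ denotes integrable functions with (essentially) compact support. For $\alpha\in[0,1]$, $\mathrm{Lip}^\alpha(g)=\sup_{x\ne y}|g(x)-g(y)|/|x-y|^\alpha$ and $\mathrm{Lip}=\mathrm{Lip}^1$. For $u\in L^1_c(\mathbb R^n)$, $\mathbf V^\alpha(u)$ is the smallest $C\in[0,\infty]$ such that $\bigl|\int_{\mathbb R^n} u\det D(f,g^1,\dots,g^{n-1})\,dx\bigr|\le C\,\mathrm{Lip}^\alpha(f)\,\mathrm{Lip}(g^1)\cdots\mathrm{Lip}(g^{n-1})$ for all $f,g^1,\dots,g^{n-1}\in\mathrm{Lip}(\mathbb R^n)$, and $\mathrm{BV}^\alpha_c(\mathbb R^n)=\{u\in L^1_c(\mathbb R^n):\mathbf V^\alpha(u)<\infty\}$. *)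

(* Defs.v *)
From HB Require Import structures.
From mathcomp Require Import all_boot all_order all_algebra.
From mathcomp Require Import all_classical all_reals all_analysis.

Set Implicit Arguments.
Unset Strict Implicit.
Unset Printing Implicit Defensive.

Import Order.TTheory GRing.Theory Num.Theory.
Import numFieldNormedType.Exports.

Local Open Scope classical_set_scope.
Local Open Scope ring_scope.

(* Row vectors carry the sigma-algebra generated by the coordinate projections,
   as n.-tuple T does in the library. For T = R it is the Borel sigma-algebra. *)
Definition measure_rV_display : measure_display -> measure_display.
Proof. exact. Qed.

Section measurable_rV.
Context {d : measure_display} {T : sigmaRingType d}.
Variable n : nat.

Let coord : 'I_n -> 'rV[T]_n -> T := fun i x => x ord0 i.

Let rV_set0 : g_sigma_preimage coord set0.
Proof. exact: sigma_algebra0. Qed.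

Let rV_setC A : g_sigma_preimage coord A -> g_sigma_preimage coord (~` A).
Proof. exact: sigma_algebraC. Qed.

Let rV_bigcup (F : _^nat) : (forall i, g_sigma_preimage coord (F i)) ->
  g_sigma_preimage coord (\bigcup_i (F i)).
Proof. exact: sigma_algebra_bigcup. Qed.

HB.instance Definition _ := @isMeasurable.Build (measure_rV_display d)
  'rV[T]_n (g_sigma_preimage coord) rV_set0 rV_setC rV_bigcup.

Lemma measurable_coord (i : 'I_n) :
  measurable_fun [set: 'rV[T]_n] (fun x : 'rV[T]_n => x ord0 i).
Proof.
move=> _ Y mY; rewrite setTI; apply: sub_sigma_algebra => /=.
rewrite -bigcup_seq/=; exists i => /=; first by rewrite mem_index_enum.
by exists Y => //; rewrite setTI.
Qed.

End measurable_rV.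

Lemma measurable_fun_rVP d1 d2 (T1 : measurableType d1)
    (T2 : measurableType d2) n (f : T1 -> 'rV[T2]_n) :
  (forall i, measurable_fun [set: T1] (fun x => f x ord0 i)) ->
  measurable_fun [set: T1] f.
Proof.
move=> mf _ A mA; rewrite setTI.
suff : [set B | measurable (f @^-1` B)] A by [].
apply: (mA [set B | measurable (f @^-1` B)]); split.
  split=> /=; first by rewrite preimage_set0.
  - by move=> B mB; rewrite setTD preimage_setC; exact: measurableC.
  - by move=> F mF; rewrite preimage_bigcup; exact: bigcup_measurable.
case: n f A mA mf => [f A _ _|n f A _ mf]; first by rewrite big_ord0.
rewrite -bigcup_mkord_ord; apply: bigcup_sub => i Ii _ [B mB <-] /=.
by rewrite setTI -[X in measurable X]setTI; exact: mf.
Qed.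

Section lebesgue_rV.
Context {R : realType}.

Definition rV_cons n (p : R * 'rV[R]_n) : 'rV[R]_n.+1 :=
  row_mx (\row_(_ < 1) p.1) p.2.

Definition rV_uncons n (x : 'rV[R]_n.+1) : R * 'rV[R]_n :=
  (x ord0 ord0, \row_i x ord0 (lift ord0 i)).

Lemma rV_cons0 n (p : R * 'rV[R]_n) : rV_cons p ord0 ord0 = p.1.
Proof.
rewrite /rV_cons (_ : ord0 = lshift n (ord0 : 'I_1)); last exact/val_inj.
by rewrite (@row_mxEl _ 1 1 n) mxE.
Qed.

Lemma rV_consS n (p : R * 'rV[R]_n) i :
  rV_cons p ord0 (lift ord0 i) = p.2 ord0 i.
Proof.
rewrite /rV_cons (_ : lift ord0 i = rshift 1 i); last exact/val_inj.
by rewrite (@row_mxEr _ 1 1 n).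
Qed.

Lemma rV_consK n : cancel (@rV_cons n) (@rV_uncons n).
Proof.
move=> -[a x]; rewrite /rV_uncons rV_cons0; congr pair.
by apply/rowP => i; rewrite mxE rV_consS.
Qed.

Lemma measurable_rV_cons n : measurable_fun setT (@rV_cons n).
Proof.
apply: measurable_fun_rVP => i.
have [j ->|->] := unliftP ord0 i.
- rewrite (_ : (fun _ => _) =
      (fun x : 'rV[R]_n => x ord0 j) \o (snd : R * 'rV[R]_n -> _)).
    by apply: measurableT_comp => //; exact: measurable_coord.
  by apply/funext => p /=; rewrite rV_consS.
- rewrite (_ : (fun _ => _) = (fst : R * 'rV[R]_n -> _)) //.
  by apply/funext => p /=; rewrite rV_cons0.
Qed.

Lemma measurable_rV_uncons n : measurable_fun setT (@rV_uncons n).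
Proof.
apply/measurable_fun_pairP; split => /=.
  exact: (@measurable_coord _ R n.+1 ord0).
apply: measurable_fun_rVP => i /=.
rewrite (_ : (fun _ => _) = (fun x : 'rV[R]_n.+1 => x ord0 (lift ord0 i))).
  exact: measurable_coord.
by apply/funext => x; rewrite mxE.
Qed.

Section lebesgue_rVS.
Variables (n : nat) (m : {sigma_finite_measure set 'rV[R]_n -> \bar R}).

Definition lebesgue_rVS : set 'rV[R]_n.+1 -> \bar R :=
  pushforward (@lebesgue_measure R \x m)%E (@rV_cons n).

Let lebesgue_rVS0 : lebesgue_rVS set0 = 0%E.
Proof. by apply: measure0; exact: measurable_rV_cons. Qed.

Let lebesgue_rVS_ge0 A : (0 <= lebesgue_rVS A)%E.
Proof. by apply: measure_ge0; exact: measurable_rV_cons. Qed.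

Let lebesgue_rVS_semi_sigma_additive : semi_sigma_additive lebesgue_rVS.
Proof.
apply: measure_semi_sigma_additive; exact: measurable_rV_cons.
Qed.

HB.instance Definition _ := isMeasure.Build _ _ _ lebesgue_rVS
  lebesgue_rVS0 lebesgue_rVS_ge0 lebesgue_rVS_semi_sigma_additive.

Let lebesgue_rVS_sigma_finite : sigma_finite setT lebesgue_rVS.
Proof.
have /sigma_finiteP[F [TF ndF Foo]] := sigma_finiteT (@lebesgue_measure R).
have /sigma_finiteP[G [TG ndG Goo]] := sigma_finiteT m.
exists (fun k => @rV_uncons n @^-1` (F k `*` G k)).
  rewrite -preimage_bigcup -(preimage_setT (@rV_uncons n)); congr (_ @^-1` _).
  rewrite -setXTT TF TG predeqE => -[x y]; split.
    move=> [/= [k _ Fkx] [l _ Gly]]; exists (maxn k l) => //; split.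
    - by move: x Fkx; exact/subsetPset/ndF/leq_maxl.
    - by move: y Gly; exact/subsetPset/ndG/leq_maxr.
  by move=> [k _ []/= ? ?]; split; exists k.
move=> k; have [mF ?] := Foo k; have [mG ?] := Goo k; split.
  rewrite -[X in measurable X]setTI; apply: measurable_rV_uncons => //.
  exact: measurableX.
rewrite /lebesgue_rVS /pushforward -comp_preimage.
rewrite (_ : _ \o _ = id) ?preimage_id; last first.
  by apply/funext => p; rewrite /= rV_consK.
by rewrite product_measure1E// lte_mul_pinfty// ge0_fin_numE.
Qed.

HB.instance Definition _ := Measure_isSigmaFinite.Build _ _ _ lebesgue_rVS
  lebesgue_rVS_sigma_finite.

End lebesgue_rVS.

Fixpoint lebesgue_rV n : {sigma_finite_measure set 'rV[R]_n -> \bar R} :=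
  if n is n'.+1 then lebesgue_rVS (lebesgue_rV n')
  else \d_(0 : 'rV[R]_0).

End lebesgue_rV.

Section fractional_variation.
Context {R : realType} {n : nat}.
Implicit Types (a : R) (f u : 'rV[R]_n.+1 -> R) (g : 'I_n -> 'rV[R]_n.+1 -> R).

Local Notation mu := (@lebesgue_rV R n.+1).

(* The library's norm on matrices is the sup norm, whereas Lipschitz constants
   are taken with respect to the Euclidean one. *)
Definition enorm (x : 'rV[R]_n.+1) : R :=
  Num.sqrt (\sum_i x ord0 i ^+ 2).

Definition Lipa a f : \bar R :=
  ereal_sup [set r | exists x y : 'rV[R]_n.+1,
    x != y /\ r = (`|f x - f y| / enorm (x - y) `^ a)%:E].

Definition Lip f : \bar R := Lipa 1 f.

(* The Jacobian matrix of (f, g^1, ..., g^n), with f in row 0. It only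
   matters where the components are differentiable, which is almost everywhere
   for Lipschitz functions; elsewhere the derivatives have default values. *)
Definition Dmx f g (x : 'rV[R]_n.+1) : 'M[R]_n.+1 :=
  \matrix_(i, j)
    'D_(delta_mx ord0 j) (if unlift ord0 i is Some k then g k else f) x.

(* The smallest admissible constant: the infimum is attained. With 0 * +oo = 0,
   the constraint for Lipschitz f with infinite Lipa a f forces nothing new when
   C = 0 either, u having compact support. *)
Definition Valpha a u : \bar R :=
  ereal_inf [set C : \bar R | (0 <= C)%E /\
    forall f g, (Lip f < +oo)%E -> (forall i, Lip (g i) < +oo)%E ->
      (`| \int[mu]_x (u x * \det (Dmx f g x))%:E |
         <= C * Lipa a f * \prod_(i < n) Lip (g i))%E].

Definition spt u : set 'rV[R]_n.+1 :=
  ~` \bigcup_(U in [set U : set 'rV[R]_n.+1 |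
                    open U /\ {ae mu, forall x, U x -> u x = 0}]) U.

Definition L1c u : Prop :=
  mu.-integrable setT (EFin \o u) /\ compact (spt u).

Definition BVc a u : Prop := L1c u /\ (Valpha a u < +oo)%E.

Definition L1norm u : \bar R := 'N[mu]_1[EFin \o u]%E.

End fractional_variation.

(* Main.v *)
(* Testing V^a(u) against g^k = the coordinates gives |int u d_i F| <= C Lip^a(F)
   for each direction i, so u is tested only against derivatives of regular
   functions. For f Lipschitz with |f| <= 1, let A_s f be the average of f over
   the cubes x + [0, s]^n. Changing s into 2 s one coordinate at a time changes
   A_s f by d_i F with |F| <= s / 2 and F Lipschitz with a constant independent
   of s and f, hence Lip^a(F) <= c s^(1 - a) by interpolation. Summing over
   dyadic scales, a geometric series because a < 1,
     |int u f| <= |int u A_S f| + c V^a(u) S^(1 - a).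
   Taking the supremum over f controls |u|_1 by the integrals of u against
   functions that are Lipschitz with constant 2 / S, and these are determined up
   to a small error by the integrals of u over finitely many small sets.
   Along an ultrafilter on the indices all these integrals converge, so (u_k) is
   Cauchy in L^1 along it. The ultrafilter is chosen to see the indices at which
   V^a(u_k) is close to its lower limit. No property of Lebesgue measure enters:
   averages are only ever taken of test functions, along lines. *)
Require Import Defs.
From mathcomp Require Import all_boot all_order all_algebra.
From mathcomp Require Import all_classical all_reals all_analysis.
From mathcomp Require Import measurable_realfun ring lra.
Import Order.TTheory GRing.Theory Num.Theory.
Import numFieldNormedType.Exports.
Local Open Scope classical_set_scope.
Local Open Scope ring_scope.
Set Implicit Arguments.
Unset Strict Implicit.
Unset Printing Implicit Defensive.

(** * Averages along a line *)

(** F has a Lipschitz constant free of s and f because averaging at scale s turns the bound |f| <= 1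
    into a Lipschitz constant 2 / s in every direction, and F carries a factor s / 2. The original
    constant of f only decides how small the first scale must be, and it disappears when that scale
    tends to 0. The sides of a cube are doubled one at a time because only then is the change a
    single directional derivative. The supremum over Lipschitz f with |f| <= 1 is the full L^1 norm,
    since the sign of w is a limit of such functions in L^1(|w| mu). The ultrafilter takes the place
    of a diagonal extraction: it settles every bounded real family, whatever the partition, and a
    single subsequence is drawn at the end from countably many of its members. *)

Definition dlip {R : realType} {V : normedModType R} (e : V) (L : R)
    (f : V -> R) :=
  forall x h, `|f (x + h *: e) - f x| <= L * `|h|.

Section average.
Context {R : realType} {V : normedModType R}.
Implicit Types (e v x : V) (f g : V -> R) (c C : R -> R) (L s t B : R).

(** Integrating from -1 puts 0 in the interior, so the primitive has a two-sided derivative on a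
    neighbourhood of [[0, s]]. *)
Lemma ex_primitive c : continuous c ->
  exists C, forall t, -1 < t -> is_derive t 1 C (c t).
Proof.
move=> cc; exists (fun t => \int[lebesgue_measure]_(x in `[-1, t]) c x).
move=> t t1.
have tt1 : t < t + 1 by rewrite ltrDl.
have [] := @continuous_FTC1_closed R c (-1) t (t + 1) tt1 _ t1 (cc t).
  apply: continuous_compact_integrable; first exact: segment_compact.
  exact: continuous_subspaceT.
by move=> d dE; apply: DeriveDef => //; rewrite -derive1E dE.
Qed.

(** Plays the part of the estimate of an integral by its integrand: averages are handled through
    derivatives of primitives only. *)
Lemma MVT_bound c C s B : 0 <= s ->
  (forall t, 0 <= t <= s -> is_derive t 1 C (c t)) ->
  (forall t, 0 <= t <= s -> `|c t| <= B) -> `|C s - C 0| <= B * s.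
Proof.
move=> s0 dC cB.
have [||t ts ->] := @MVT_segment R C c 0 s s0.
- by move=> x; rewrite in_itv/= => /andP[x0 xs]; apply: dC; rewrite !ltW.
- apply: derivable_within_continuous => x; rewrite in_itv/= => xs.
  exact: (@ex_derive _ _ _ _ _ _ _ (dC x xs)).
- by rewrite subr0 normrM (ger0_norm s0) ler_wpM2r// cB// -in_itv.
Qed.

Lemma primitive_unique c C C' s : 0 <= s ->
  (forall t, 0 <= t <= s -> is_derive t 1 C (c t)) ->
  (forall t, 0 <= t <= s -> is_derive t 1 C' (c t)) -> C s - C 0 = C' s - C' 0.
Proof.
move=> s0 dC dC'; apply/eqP; rewrite -subr_eq0 -normr_le0.
rewrite (_ : _ - _ = (C - C') s - (C - C') 0); last by rewrite !fctE; lra.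
rewrite -[leRHS](mul0r s); apply: (@MVT_bound (fun t => c t - c t)) => // t ts.
  by apply: is_deriveB; [exact: dC|exact: dC'].
by rewrite subrr normr0.
Qed.

Lemma dlip_line_continuous e L f x :
  dlip e L f -> continuous (fun t => f (x + t *: e)).
Proof.
move=> fL t; have L0 : 0 <= L.
  by have := fL x 1; rewrite normr1 mulr1; exact: le_trans.
apply/cvgrPdist_le => /= d d0; near=> t'.
rewrite distrC -[t'](subrK t) (addrC _ t) scalerDl addrA.
apply: (le_trans (fL _ _)).
have : `|t' - t| <= d / (L + 1).
  rewrite distrC; near: t'.
  by apply: cvgr_dist_le; [exact: cvg_id|rewrite divr_gt0// ltr_wpDl].
rewrite ler_pdivlMr ?ltr_wpDl// => h.
apply: le_trans h; rewrite mulrC ler_wpM2l//; lra.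
Unshelve. all: by end_near. Qed.

(** An arbitrary choice; by [primitive_unique] the differences of its values do not depend on it. *)
Definition primitive c : R -> R :=
  xget (fun=> 0) [set C | forall t, -1 < t -> is_derive t 1 C (c t)].

Lemma primitiveP c t : continuous c -> -1 < t ->
  is_derive t 1 (primitive c) (c t).
Proof.
move=> /ex_primitive[C dC] t1; rewrite /primitive.
by case: xgetP => [C' _ /(_ _ t1)//|/(_ C)].
Qed.

(* The mean of f over [x, x + s e]; the primitive is only controlled on ]-1, +oo[. *)
Definition avg e s f x : R :=
  s^-1 * (primitive (fun t => f (x + t *: e)) s -
          primitive (fun t => f (x + t *: e)) 0).

(** Constants, displacement along [e], doubling and linearity each reduce to exhibiting a suitable
    primitive [C]. *)
Lemma avgE e s f x L C : 0 <= s -> dlip e L f ->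
  (forall t, 0 <= t <= s -> is_derive t 1 C (f (x + t *: e))) ->
  avg e s f x = s^-1 * (C s - C 0).
Proof.
move=> s0 fL dC; rewrite /avg; congr *%R.
apply: (@primitive_unique (fun t => f (x + t *: e))) => // t /andP[t0 _].
apply: primitiveP; first exact: dlip_line_continuous fL.
by rewrite (lt_le_trans _ t0)// oppr_lt0.
Qed.

(** Two functions and two base points at once: this gives the sup bound, the Lipschitz bound and the
    distance from [f] to its average. *)
Lemma avg_dist e s f g x y L L' B : 0 < s -> dlip e L f -> dlip e L' g ->
  (forall t, 0 <= t <= s -> `|f (x + t *: e) - g (y + t *: e)| <= B) ->
  `|avg e s f x - avg e s g y| <= B.
Proof.
move=> s0 fL gL fgB; rewrite /avg.
set C := primitive _; set D := primitive _.
have -> : s^-1 * (C s - C 0) - s^-1 * (D s - D 0) =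
  s^-1 * ((C - D) s - (C - D) 0) by rewrite !fctE; ring.
rewrite normrM gtr0_norm ?invr_gt0// mulrC ler_pdivrMr//.
apply: (@MVT_bound (fun t => f (x + t *: e) - g (y + t *: e))); rewrite ?ltW//.
move=> t /andP[t0 _]; have t1 : -1 < t by lra.
apply: is_deriveB; apply: primitiveP => //.
  exact: dlip_line_continuous fL.
exact: dlip_line_continuous gL.
Qed.

Lemma dlip_cst e a : dlip e 0 (fun=> a : R).
Proof. by move=> x h; rewrite subrr normr0 mul0r. Qed.

Lemma avg_cst e s a x : 0 < s -> avg e s (fun=> a) x = a.
Proof.
move=> s0; have dC t : 0 <= t <= s -> is_derive t 1 (fun t => a * t) a.
  by move=> _; apply: is_derive_eq; exact: mulr1.
rewrite (avgE (ltW s0) (@dlip_cst e a) dC).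
by rewrite mulr0 subr0 mulrC mulfK// gt_eqF.
Qed.

Lemma avg_norm e s f x L B : 0 < s -> dlip e L f ->
  (forall y, `|f y| <= B) -> `|avg e s f x| <= B.
Proof.
move=> s0 fL fB.
rewrite -[avg _ _ _ _]subr0 -(@avg_cst e s 0 x)//.
apply: (avg_dist s0 fL (dlip_cst e 0)) => t _; by rewrite subr0.
Qed.

Lemma avg_shift e s f v x : avg e s (fun y => f (y + v)) x = avg e s f (x + v).
Proof.
rewrite /avg; have -> // : (fun t => f (x + t *: e + v)) =
  (fun t => f (x + v + t *: e)).
by apply/funext => t; rewrite addrAC.
Qed.

Lemma avg_dlip e s f L e' L' : 0 < s -> dlip e L f -> dlip e' L' f ->
  dlip e' L' (avg e s f).
Proof.
move=> s0 fL fL' x h; apply: (avg_dist s0 fL fL) => t _.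
by rewrite addrAC; exact: fL'.
Qed.

Lemma is_derive_shift t s : is_derive t 1 (fun u => u + s) 1.
Proof.
rewrite -[X in is_derive _ _ _ X]addr0.
exact: (@is_deriveD _ _ _ id (cst s)).
Qed.

Lemma is_derive_lineP f x v (d : R) :
  is_derive x v f d <-> is_derive (0 : R) 1 (fun h => f (h *: v + x)) d.
Proof.
have E : 'D_v f x = 'D_1 (fun h : R => f (h *: v + x)) 0.
  rewrite /derive; set g1 := fun h => h^-1 *: _; set g2 := fun h => h^-1 *: _.
  suff -> : g1 = g2 by [].
  by rewrite funeqE /g1 /g2 => h /=; rewrite addr0 scale0r add0r [_%:A]mulr1.
by split=> -[fd fE]; split; [exact: (derivable1P f x v).1|rewrite -fE|
  exact: (derivable1P f x v).2|rewrite -fE].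
Qed.

(** Moving the base point along [e] slides the window on one line, so near [x] the function is
    [C (h + s) - C h] for a single primitive [C]. *)
Lemma avg_is_derive e s f L x : 0 < s -> dlip e L f ->
  is_derive x e (fun x => s * avg e s f x) (f (x + s *: e) - f x).
Proof.
move=> s0 fL; have fc : continuous (fun t => f (x + t *: e)).
  exact: dlip_line_continuous fL.
set C := primitive (fun t => f (x + t *: e)).
have dC t : -1 < t -> is_derive t 1 C (f (x + t *: e)) by exact: primitiveP.
pose D := (fun h => C (h + s) - C h).
have dD : is_derive (0 : R) 1 D (f (x + s *: e) - f x).
  rewrite /D; apply: is_deriveB; last first.
    by rewrite -[X in f X](addr0 x) -(scale0r e); apply: dC; lra.
  have := @is_derive1_comp R C (fun h => h + s) 0.
  rewrite add0r; move=> /(_ (f (x + s *: e)) 1); rewrite mulr1.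
  apply; first by apply: dC; lra.
  exact: is_derive_shift.
have DE : \forall h \near 0, s * avg e s f (h *: e + x) = D h.
  near=> h.
  have h1 : `|h| < 1.
    near: h; apply/nbhs_ballP; exists 1 => //= y.
    by rewrite -ball_normE /= sub0r normrN.
  have dCh t : 0 <= t <= s ->
      is_derive t 1 (fun t => C (t + h)) (f (h *: e + x + t *: e)).
    move=> /andP[t0 _]; rewrite -(mulr1 (f _)).
    rewrite (_ : _ + _ + _ = x + (t + h) *: e); last first.
      by rewrite scalerDl -addrA addrCA (addrC (h *: e)).
    apply: is_derive1_comp; last exact: is_derive_shift.
    apply: dC; suff : -1 < h by lra.
    by move: h1; rewrite ltr_norml => /andP[].
  rewrite (avgE (ltW s0) fL dCh).
  by rewrite mulrA divff ?gt_eqF// mul1r add0r /D (addrC h).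
apply/is_derive_lineP; apply: near_eq_is_derive dD.
by near do apply/esym.
Unshelve. all: by end_near. Qed.

(** The derivative of [s * avg e s f] is a difference of two values of [f], so the new constant
    comes from the bound [B] and not from [L]. *)
Lemma avg_dlip_gain e s f L B : 0 < s -> dlip e L f ->
  (forall y, `|f y| <= B) -> dlip e (2 * B / s) (avg e s f).
Proof.
move=> s0 fL fB.
have key x (h : R) : 0 <= h -> `|avg e s f (x + h *: e) - avg e s f x| <= 2 * B / s * h.
  move=> h0; pose G r := s * avg e s f (x + r *: e).
  have dG (r : R) : is_derive r 1 G (f (x + r *: e + s *: e) - f (x + r *: e)).
    have := avg_is_derive (x + r *: e) s0 fL => /is_derive_lineP dA.
    have := @is_derive1_comp R _ (fun t => t - r) r _ 1.
    rewrite subrr => /(_ _ _ dA (is_derive_shift _ _)); rewrite mulr1.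
    congr is_derive; apply/funext => t; rewrite /G /=; congr (_ * avg _ _ _ _).
    by rewrite addrCA -scalerDl subrK.
  have := @MVT_bound _ G h (2 * B) h0 (fun t _ => dG t).
  rewrite /G scale0r addr0 -mulrBr normrM gtr0_norm// => H.
  rewrite mulrAC ler_pdivlMr// mulrC; apply: H => t _.
  by apply: le_trans (ler_normB _ _) _; rewrite mulr2n mulrDl !mul1r lerD.
move=> x h; have [h0|h0] := leP 0 h.
  by rewrite (ger0_norm h0); exact: key.
have := key (x + h *: e) (- h); rewrite oppr_ge0 (ltW h0) => /(_ isT).
by rewrite (ltr0_norm h0) -addrA scaleNr subrr addr0 distrC.
Qed.

Lemma avg_double e s f L x : 0 < s -> dlip e L f ->
  avg e (2 * s) f x = (avg e s f (x + s *: e) + avg e s f x) / 2.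
Proof.
move=> s0 fL; have fc : continuous (fun t => f (x + t *: e)).
  exact: dlip_line_continuous fL.
set C := primitive (fun t => f (x + t *: e)).
have dC t : -1 < t -> is_derive t 1 C (f (x + t *: e)) by exact: primitiveP.
have dC0 t s' : 0 <= t <= s' -> is_derive t 1 C (f (x + t *: e)).
  by move=> /andP[t0 _]; apply: dC; lra.
have dCs t : 0 <= t <= s ->
    is_derive t 1 (fun u => C (u + s)) (f (x + s *: e + t *: e)).
  move=> /andP[t0 ts]; rewrite -(mulr1 (f _)) -addrA -scalerDl (addrC s).
  apply: is_derive1_comp; last exact: is_derive_shift.
  by apply: dC; lra.
rewrite (avgE _ fL (dC0 ^~ (2 * s))) ?(avgE (ltW s0) fL (dC0 ^~ s)) //; last lra.
rewrite (avgE (ltW s0) fL dCs) add0r (_ : s + s = 2 * s); last by ring.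
by field; rewrite gt_eqF.
Qed.

Lemma avg_near e s f L x : 0 < s -> dlip e L f -> `|avg e s f x - f x| <= L * s.
Proof.
move=> s0 fL; rewrite -[X in _ - X](@avg_cst e s (f x) x)//.
apply: (avg_dist s0 fL (dlip_cst e (f x))) => t /andP[t0 ts].
apply: (le_trans (fL _ _)); rewrite ger0_norm// ler_wpM2l//.
by have := fL x 1; rewrite normr1 mulr1; exact: le_trans.
Qed.

Lemma dlip_lin e L L' f g a b : dlip e L f -> dlip e L' g ->
  dlip e (`|a| * L + `|b| * L') (fun x => a * f x + b * g x).
Proof.
move=> fL gL x h; rewrite mulrDl opprD addrACA -!mulrBr.
by apply: (le_trans (ler_normD _ _)); rewrite !normrM -!mulrA lerD// ler_wpM2l.
Qed.

Lemma avg_lin e s L L' f g a b x : 0 < s -> dlip e L f -> dlip e L' g ->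
  avg e s (fun x => a * f x + b * g x) x = a * avg e s f x + b * avg e s g x.
Proof.
move=> s0 fL gL; set C := primitive (fun t => f (x + t *: e)).
set D := primitive (fun t => g (x + t *: e)).
have dC t : 0 <= t <= s -> is_derive t 1 C (f (x + t *: e)).
  by move=> /andP[t0 _]; apply: primitiveP; [exact: dlip_line_continuous fL|lra].
have dD t : 0 <= t <= s -> is_derive t 1 D (g (x + t *: e)).
  by move=> /andP[t0 _]; apply: primitiveP; [exact: dlip_line_continuous gL|lra].
have dCD t : 0 <= t <= s ->
    is_derive t 1 (a *: C + b *: D) (a * f (x + t *: e) + b * g (x + t *: e)).
  move=> ts; apply: is_deriveD; apply: is_deriveZ; [exact: dC|exact: dD].
rewrite (avgE (ltW s0) (dlip_lin a b fL gL) dCD).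
rewrite (avgE (ltW s0) fL dC) (avgE (ltW s0) gL dD) !fctE.
rewrite /GRing.scale/=; ring.
Qed.

End average.

(** * Averages over cubes and smoothing of test functions *)

Section mixed_average.
Context {R : realType} {V : normedModType R} {I : eqType} (e : I -> V).
Implicit Types (f : V -> R) (l : seq (I * R)) (i : I) (s L B : R).

(** Pairs (direction, length) allow boxes with sides of mixed lengths, the intermediate stages
    between two cubes. A side is doubled in place, so averages in different directions never have to
    be commuted. *)
Definition avgs l f : V -> R := foldr (fun p g => avg (e p.1) p.2 g) f l.

Let pos l := all (fun p : I * R => 0 < p.2) l.

Lemma avgs_dlip l f L : pos l -> (forall i, dlip (e i) L f) ->
  forall i, dlip (e i) L (avgs l f).
Proof.
move=> + fL; elim: l => //= p l IH /andP[p0 /IH{}IH] i.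
exact: avg_dlip p0 (IH p.1) (IH i).
Qed.

Lemma avgs_norm l f L B : pos l -> (forall i, dlip (e i) L f) ->
  (forall x, `|f x| <= B) -> forall x, `|avgs l f x| <= B.
Proof.
move=> + fL fB; elim: l => //= p l IH /andP[p0 l0] x.
exact: (avg_norm x p0 (avgs_dlip l0 fL p.1) (IH l0)).
Qed.

Lemma avgs_gain l f L B s i : 0 < s -> all (fun p : I * R => s <= p.2) l ->
  (forall i, dlip (e i) L f) -> (forall x, `|f x| <= B) ->
  i \in map fst l -> dlip (e i) (2 * B / s) (avgs l f).
Proof.
move=> s0 + fL fB; elim: l => //= p l IH /andP[sp sl].
have l0 : pos l by apply: sub_all sl => q; exact: lt_le_trans.
have p0 : 0 < p.2 by exact: lt_le_trans sp.
rewrite inE => /predU1P[->|il]; last first.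
  by apply: (avg_dlip p0 (avgs_dlip l0 fL p.1)); exact: IH.
have B0 : 0 <= B by apply: le_trans (fB 0).
move=> x h; apply: le_trans (avg_dlip_gain p0 (avgs_dlip l0 fL p.1) _ x h) _.
  exact: avgs_norm fB.
by rewrite ler_wpM2r// ler_wpM2l ?mulr_ge0// lef_pV2.
Qed.

(** The averages in [l1], applied after the doubled one, are linear and commute with translations,
    so the identity of [avg_double] passes through them. *)
Lemma avgs_double l1 l2 f L s i x : 0 < s -> pos l1 -> pos l2 ->
  (forall i, dlip (e i) L f) ->
  avgs (l1 ++ (i, 2 * s) :: l2) f x =
  (avgs (l1 ++ (i, s) :: l2) f (x + s *: e i) +
   avgs (l1 ++ (i, s) :: l2) f x) / 2.
Proof.
move=> s0 + l20 fL; elim: l1 x => [x _|p l1 IH x /= /andP[p0 l10]] /=.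
  exact: (avg_double _ s0 (avgs_dlip l20 fL i)).
set g := avgs (l1 ++ (i, s) :: l2) f.
have gL j : dlip (e j) L g.
  by apply: avgs_dlip fL _; rewrite /pos all_cat/= s0 -/(pos l1) l10.
rewrite (_ : avgs _ f =
    fun x => 2^-1 * g (x + s *: e i) + 2^-1 * g x); last first.
  by apply/funext => y; rewrite IH// mulrC mulrDr.
have gsL : dlip (e p.1) L (fun y => g (y + s *: e i)).
  by move=> y h; rewrite addrAC; exact: gL.
rewrite (avg_lin 2^-1 2^-1 x p0 gsL (gL p.1)).
by rewrite avg_shift [RHS]mulrC mulrDr.
Qed.

Lemma avgs_near l f L s x : (forall i, dlip (e i) L f) -> 0 < s ->
  all (fun p : I * R => p.2 == s) l ->
  `|avgs l f x - f x| <= (size l)%:R * (L * s).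
Proof.
move=> fL s0; elim: l x => [|p l IH] x /=; first by rewrite subrr normr0 mul0r.
move=> /andP[/eqP ps ls].
have l0 : pos l by apply: sub_all ls => q /eqP ->.
rewrite -(subrK (avgs l f x) (avg _ _ _ _)) -addrA -natr1 mulrDl mul1r.
rewrite [leRHS]addrC; apply: (le_trans (ler_normD _ _)); rewrite lerD//.
  by rewrite ps; apply: avg_near => //; exact: avgs_dlip.
exact: IH.
Qed.

End mixed_average.

(** * Dyadic smoothing of Lipschitz test functions *)

Section smoothing.
Context {R : realType} {n : nat}.
Implicit Types (f F : 'rV[R]_n.+1 -> R) (s L B a : R) (x y : 'rV[R]_n.+1).

Local Notation e i := (delta_mx ord0 i : 'rV[R]_n.+1).

(* This is the Lipschitz condition for the l^1 norm, see lipschitz_l1. *)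
Definition coord_lipschitz L f := forall i, dlip (e i) L f.

Definition bounded_lipschitz f :=
  (exists B, forall x, `|f x| <= B) /\ exists L, coord_lipschitz L f.

Lemma lipschitz_ge0 L f : coord_lipschitz L f -> 0 <= L.
Proof. by move=> /(_ ord0 0 1); rewrite normr1 mulr1; exact: le_trans. Qed.

Lemma coord_le_enorm x i : `|x ord0 i| <= enorm x.
Proof.
rewrite -sqrtr_sqr ler_wsqrtr// (bigD1 i)//= lerDl.
by apply: sumr_ge0 => j _; exact: sqr_ge0.
Qed.

Lemma enorm_ge0 x : 0 <= enorm x.
Proof. exact: sqrtr_ge0. Qed.

Lemma lipschitz_l1 L f x y : coord_lipschitz L f ->
  `|f x - f y| <= L * \sum_i `|(x - y) ord0 i|.
Proof.
move=> fL; rewrite -{1}(subrK y x) [X in f (X + _)]row_sum_delta.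
elim/big_rec2 : _ => [|i u v _ IH].
  by rewrite add0r subrr normr0 mulr0.
rewrite mulrDr -(subrK (f (v + y)) (f _)) -addrA.
apply: (le_trans (ler_normD _ _)); rewrite lerD//.
by rewrite -addrA addrC; exact: fL.
Qed.

Lemma lipschitz_enorm L f x y : coord_lipschitz L f ->
  `|f x - f y| <= n.+1%:R * L * enorm (x - y).
Proof.
move=> fL; apply: (le_trans (lipschitz_l1 x y fL)).
rewrite (mulrC n.+1%:R) -mulrA ler_wpM2l ?(lipschitz_ge0 fL)//.
rewrite mulr_natl -[X in _ *+ X]card_ord -sumr_const.
by apply: ler_sum => i _; exact: coord_le_enorm.
Qed.

Lemma lipschitz_norm L f x y : coord_lipschitz L f ->
  `|f x - f y| <= n.+1%:R * L * `|x - y|.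
Proof.
move=> fL; apply: (le_trans (lipschitz_l1 x y fL)).
rewrite (mulrC n.+1%:R) -mulrA ler_wpM2l ?(lipschitz_ge0 fL)//.
rewrite mulr_natl -[X in _ *+ X]card_ord -sumr_const.
apply: ler_sum => i _; rewrite [leRHS]/Num.norm /= mx_normrE.
by apply/bigmax_geP; right; exists (ord0, i).
Qed.

Lemma lipschitz_continuous L f : coord_lipschitz L f -> continuous f.
Proof.
move=> fL x; have N0 : 0 <= n.+1%:R * L by rewrite mulr_ge0// (lipschitz_ge0 fL).
apply/(@cvgrPdist_le _ _ _ (nbhs x) (nbhs_filter x)) => d d0; near=> y.
apply: (le_trans (lipschitz_norm x y fL)).
have : `|x - y| <= d / (n.+1%:R * L + 1).
  near: y; apply: cvgr_dist_le; [exact: cvg_id|rewrite divr_gt0// ltr_wpDl//].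
rewrite ler_pdivlMr ?ltr_wpDl// mulrC => h.
by apply: le_trans h; rewrite ler_wpM2r// lerDl.
Unshelve. all: by end_near. Qed.

(** The two bounds give [N] times the minimum of [s] and [d], which is at most their weighted
    geometric mean. *)
Lemma holder_interpolation (N q d s a : R) : 0 <= N -> 0 <= d -> 0 < s ->
  0 <= a < 1 -> q <= N * s -> q <= N * d -> q <= N * s `^ (1 - a) * d `^ a.
Proof.
move=> N0 d0 s0 /andP[a0 a1] qs qd; rewrite -mulrA.
have [d00|dn0] := eqVneq d 0.
  by rewrite (le_trans qd)// d00 mulr0 !mulr_ge0// powR_ge0.
have {}d0 : 0 < d by rewrite lt_neqAle eq_sym dn0.
have split (t : R) : 0 < t -> t = t `^ (1 - a) * t `^ a.
  move=> t0; rewrite -powRD ?subrK ?powRr1// ?ltW//.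
  by rewrite (gt_eqF t0) implybT.
have [ds|sd] := leP d s.
  apply: (le_trans qd); rewrite ler_wpM2l// {1}(split _ d0) ler_wpM2r ?powR_ge0//.
  by apply: ge0_ler_powR => //; rewrite ?nnegrE ?subr_ge0; exact: ltW.
apply: (le_trans qs); rewrite ler_wpM2l// {1}(split _ s0) ler_wpM2l ?powR_ge0//.
by apply: ge0_ler_powR => //; rewrite ?nnegrE ?subr_ge0; exact: ltW.
Qed.

Definition holder_test a D (T : ('rV[R]_n.+1 -> R) -> R) :=
  forall i F L B, coord_lipschitz L F -> (forall x, derivable F x (e i)) -> 0 <= B ->
  (forall x y, `|F x - F y| <= B * enorm (x - y) `^ a) ->
  `|T (fun x => 'D_(e i) F x)| <= D * B.

(** What the smoothing uses of integration against an L^1 function, [W] standing for its norm. *)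
Definition l1_functional W (T : ('rV[R]_n.+1 -> R) -> R) :=
  (forall f g, bounded_lipschitz f -> bounded_lipschitz g ->
     T (fun x => f x - g x) = T f - T g) /\
  (forall f B, bounded_lipschitz f -> (forall x, `|f x| <= B) ->
     `|T f| <= W * B).

(* By avgs_double the difference of the two averages is the derivative in the
   direction i of F = (s / 2) avg (e i) s X, X being the average at scale s. *)
Lemma holder_test_avgs a D T W f L s i (l1 l2 : seq ('I_n.+1 * R)) :
    0 <= a < 1 -> 0 < s -> l1_functional W T -> holder_test a D T ->
    coord_lipschitz L f -> (forall x, `|f x| <= 1) ->
    (forall j, j \in map fst (l1 ++ (i, s) :: l2)) ->
    all (fun p => s <= p.2) (l1 ++ (i, s) :: l2) ->
  `|T (avgs (fun i => e i) (l1 ++ (i, s) :: l2) f)| <=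
  `|T (avgs (fun i => e i) (l1 ++ (i, 2 * s) :: l2) f)| +
  D * (n.+1%:R * s `^ (1 - a)).
Proof.
move=> a01 s0 [Tlin _] TD fL f1 lT ls.
have : all (fun p : 'I_n.+1 * R => 0 < p.2) (l1 ++ (i, s) :: l2).
  by apply: sub_all ls => p; exact: lt_le_trans.
move=> /[dup] l0; rewrite all_cat => /andP[l10 /= /andP[_ l20]].
have l0' : all (fun p : 'I_n.+1 * R => 0 < p.2) (l1 ++ (i, 2 * s) :: l2).
  by rewrite all_cat l10/= l20 mulr_gt0.
set X := avgs _ _ f; set Y := avgs _ _ f.
have XL : coord_lipschitz (2 / s) X.
  by move=> j; rewrite -[X in X / s]mulr1; apply: (avgs_gain s0 ls fL f1 (lT j)).
have X1 x : `|X x| <= 1 by exact: (avgs_norm l0 fL f1).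
have YL : coord_lipschitz L Y by exact: avgs_dlip.
have Y1 x : `|Y x| <= 1 by exact: (avgs_norm l0' fL f1).
pose F x := 2^-1 * (s * avg (e i) s X x).
have dF x : is_derive x (e i) F (Y x - X x).
  rewrite (_ : Y x - X x = 2^-1 *: (X (x + s *: e i) - X x)).
    by apply: is_deriveZ; exact: avg_is_derive (XL i).
  rewrite /Y (avgs_double _ _ s0 l10 l20 fL) -/X /GRing.scale/=; lra.
have s20 : 0 < 2^-1 * s by rewrite mulr_gt0.
have s2N u : `|2^-1 * (s * u)| = 2^-1 * s * `|u|.
  by rewrite mulrA normrM (ger0_norm (ltW s20)).
have s2B u v : `|2^-1 * (s * u) - 2^-1 * (s * v)| = 2^-1 * s * `|u - v|.
  by rewrite -!mulrBr s2N.
have FL : coord_lipschitz 1 F.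
  move=> j x h; rewrite /F s2B.
  rewrite mulrC -ler_pdivlMr//.
  apply: (le_trans (avg_dlip s0 (XL i) (XL j) x h)).
  by rewrite -subr_ge0 (_ : _ - _ = 0)//; field; rewrite gt_eqF.
have F1 x : `|F x| <= s / 2.
  rewrite /F s2N (mulrC s) ler_piMr ?(ltW s20)//.
  exact: avg_norm (XL i) X1.
have FH x y : `|F x - F y| <= n.+1%:R * s `^ (1 - a) * enorm (x - y) `^ a.
  apply: holder_interpolation => //; first exact: enorm_ge0.
    apply: (le_trans (ler_normB _ _)); apply: (le_trans (lerD (F1 x) (F1 y))).
    by rewrite -splitr ler_peMl ?(ltW s0)// ler1n.
  by rewrite -[X in X * enorm _]mulr1; exact: lipschitz_enorm.
have := TD i F 1 (n.+1%:R * s `^ (1 - a)) FL (fun x => @ex_derive _ _ _ _ _ _ _ (dF x)).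
rewrite mulr_ge0 ?powR_ge0// => /(_ isT FH).
rewrite (_ : (fun x => _) = (fun x => Y x - X x)); last first.
  by apply/funext => x; exact: (@derive_val _ _ _ _ _ _ _ (dF x)).
rewrite Tlin; last 2 first.
- by split; [exists 1|exists L].
- by split; [exists 1|exists (2 / s)].
by move=> TYX; rewrite -lerBlDl; apply: le_trans TYX; rewrite distrC lerB_dist.
Qed.

Let cube s := [seq (i, s) | i <- enum 'I_n.+1].

(** One factor [n.+1] counts the coordinates; the other comes from comparing coordinatewise with
    Euclidean Lipschitz constants in [lipschitz_enorm]. *)
Lemma holder_test_cube a D T W f L s : 0 <= a < 1 -> 0 < s ->
    l1_functional W T -> holder_test a D T ->
    coord_lipschitz L f -> (forall x, `|f x| <= 1) ->
  `|T (avgs (fun i => e i) (cube s) f)| <=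
  `|T (avgs (fun i => e i) (cube (2 * s)) f)| +
  D * (n.+1%:R ^+ 2 * s `^ (1 - a)).
Proof.
move=> a01 s0 TW TD fL f1.
(* [l1] lists the coordinates already doubled, [l2] those still at scale [s]. *)
suff key (l1 l2 : seq 'I_n.+1) : l1 ++ l2 = enum 'I_n.+1 ->
    `|T (avgs (fun i => e i) (cube s) f)| <=
    `|T (avgs (fun i => e i) ([seq (i, 2 * s) | i <- l1] ++ [seq (i, s) | i <- l2]) f)|
    + (size l1)%:R * (D * (n.+1%:R * s `^ (1 - a))).
  have := key (enum 'I_n.+1) [::]; rewrite !cats0 => /(_ erefl).
  rewrite size_enum_ord => /le_trans; apply; rewrite lerD2l.
  by rewrite -subr_ge0 (_ : _ - _ = 0)//; ring.
(* The coordinate being doubled moves from the head of [l2] to the end of [l1], so the order of the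
   whole list is kept. *)
elim/last_ind: l1 l2 => [l2 /= l2E|l1 i IH l2].
  by rewrite mul0r addr0 /cube l2E.
rewrite cat_rcons => l12; apply: (le_trans (IH _ l12)).
rewrite size_rcons -(@natr1 _ (size l1)) (mulrDl (size l1)%:R) mul1r.
rewrite [X in _ <= _ + X]addrC addrA lerD2r.
rewrite map_rcons cat_rcons /=.
apply: (holder_test_avgs a01 s0 TW TD fL f1).
  move=> j; rewrite map_cat/= -!map_comp (eq_map (g := id))// (eq_map (f := fst \o _) (g := id))//.
  by rewrite !map_id l12 mem_enum.
rewrite all_cat/= lexx !all_map /=; apply/andP; split; apply/allP => j _ //=.
lra.
Qed.

(** The order of quantifiers matters: [k] depends on [a] and [n] alone, and neither [L] nor [W]
    survives in the conclusion. *)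
Lemma holder_test_smoothing a : 0 <= a < 1 -> exists2 k : R, 0 <= k &
  forall (D : R) T (W : R) f (L S : R), 0 < S -> 0 <= D -> l1_functional W T -> holder_test a D T ->
    coord_lipschitz L f -> (forall x, `|f x| <= 1) ->
  exists g, [/\ forall x, `|g x| <= 1, coord_lipschitz (2 / S) g &
    `|T f| <= `|T g| + k * D * S `^ (1 - a)].
Proof.
move=> a01; have [a0 a1] := andP a01.
pose q : R := 2 `^ (1 - a).
have q1 : 1 < q.
  have := @gt0_ltr_powR R (1 - a) _ 1 2; rewrite powR1; apply => //.
  - by rewrite subr_gt0.
  - by rewrite nnegrE.
  - by rewrite nnegrE.
  - by rewrite ltr1n.
(* This [k] solves [n.+1 ^ 2 + k = k * q], where [q] is the factor that [s^(1 - a)] gains under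
   doubling. *)
exists (n.+1%:R ^+ 2 / (q - 1)).
  by rewrite divr_ge0 ?exprn_ge0// subr_ge0 ltW.
set k := _ / _ => D T W f L S S0 D0 TW TD fL f1.
have k0 : 0 <= k by rewrite divr_ge0 ?exprn_ge0// subr_ge0 ltW.
(* The constant k is chosen so that this quantity is monotone under doubling. *)
have iter m s : 0 < s ->
    `|T (avgs (fun i => e i) (cube s) f)| + k * D * s `^ (1 - a) <=
    `|T (avgs (fun i => e i) (cube (2 ^+ m * s)) f)|
      + k * D * (2 ^+ m * s) `^ (1 - a).
  elim: m s => [|m IH] s s0; first by rewrite expr0 mul1r.
  rewrite (_ : 2 ^+ m.+1 * s = 2 ^+ m * (2 * s)); last by rewrite exprSr mulrA.
  apply: le_trans (IH (2 * s) _); last by rewrite mulr_gt0.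
  rewrite powRM ?(ltW s0)// -/q.
  apply: (le_trans (lerD (holder_test_cube a01 s0 TW TD fL f1) (lexx _))).
  rewrite -addrA lerD2l -subr_ge0 (_ : _ - _ = 0)//.
  by rewrite /k; field; rewrite subr_eq0 gt_eqF.
have cube0 s : 0 < s -> all (fun p : 'I_n.+1 * R => 0 < p.2) (cube s).
  by move=> s0; rewrite all_map; apply/allP.
exists (avgs (fun i => e i) (cube S) f); split.
- exact: (avgs_norm (cube0 S S0) fL f1).
- move=> i; rewrite (_ : 2 / S = 2 * 1 / S); last by rewrite mulr1.
  apply: (avgs_gain S0 _ fL f1) => //.
    by rewrite all_map; apply/allP => j _ /=.
  by rewrite -map_comp (eq_map (g := id))// map_id mem_enum.
apply/ler_addgt0Pr => eps eps0.
have L0 := lipschitz_ge0 fL.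
have W0 : 0 <= W.
  case: TW => _ /(_ (fun=> 0) 1); rewrite mulr1 => TW.
  apply: le_trans (normr_ge0 _) (TW _ _); last by move=> x; rewrite normr0.
  split; [exists 0 => x; first by rewrite normr0|exists 0 => i].
  exact: dlip_cst.
(* [C / 2 ^+ m] bounds the error of replacing [f] by its average at scale [S / 2 ^+ m]; [L] and [W]
   only influence the number [m] of doublings. *)
pose C := W * (n.+1%:R * (L * S)).
have C0 : 0 <= C by rewrite !mulr_ge0// ltW.
pose m := Num.bound (C / eps).
have Cm : C / 2 ^+ m <= eps.
  rewrite ler_pdivrMr ?exprn_gt0// mulrC -ler_pdivrMr//.
  apply: le_trans (ltW (archi_boundP _)) _; first by rewrite divr_ge0// ltW.
  by rewrite -natrX ler_nat ltnW// ltn_expl.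
pose s := S / 2 ^+ m.
have s0 : 0 < s by rewrite divr_gt0// exprn_gt0.
have := iter m s s0; rewrite /s mulrCA divff ?mulr1; last first.
  by rewrite expf_neq0// pnatr_eq0.
rewrite -/s => itm.
have gL : coord_lipschitz L (avgs (fun i => e i) (cube s) f).
  by apply: avgs_dlip => //; exact: cube0.
have g1 : forall x, `|avgs (fun i => e i) (cube s) f x| <= 1.
  exact: (avgs_norm (cube0 s s0) fL f1).
have : `|T f - T (avgs (fun i => e i) (cube s) f)| <= eps.
  case: (TW) => Tlin TB; rewrite -Tlin; last 2 first.
  - by split; [exists 1|exists L].
  - by split; [exists 1|exists L].
  apply: le_trans (TB _ (n.+1%:R * (L * s)) _ _) _.
  - split; first by exists 2 => x; rewrite (le_trans (ler_normB _ _))// (natrD _ 1 1) lerD.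
    exists (L + L) => i x h; rewrite opprD opprK addrACA mulrDl (le_trans (ler_normD _ _))//.
    rewrite lerD//; first exact: fL.
    by rewrite addrC distrC; exact: gL.
  - move=> x; rewrite distrC.
    have := @avgs_near _ _ _ (fun i => e i) (cube s) f L s x fL s0.
    rewrite /cube size_map size_enum_ord; apply.
    by rewrite all_map; apply/allP => j _ /=.
  - by apply: le_trans Cm; rewrite /C /s !mulrA.
move=> Tfg; rewrite -(subrK (T (avgs (fun i => e i) (cube s) f)) (T f)).
apply: (le_trans (ler_normD _ _)); rewrite addrC lerD//.
by apply: le_trans itm; rewrite lerDl mulr_ge0 ?powR_ge0// mulr_ge0.
Qed.

End smoothing.

(** * Measurability on row vectors *)

Section rV_topology_measure.
Context {R : realType} {n : nat}.
Implicit Types (x : 'rV[R]_n) (U : set 'rV[R]_n).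

(** A countable base of the topology made of measurable boxes: the link between open sets and the
    sigma-algebra generated by the coordinates. *)
Definition rat_ball (p : 'rV[rat]_n * nat) : set 'rV[R]_n :=
  [set x | forall i, `|x ord0 i - ratr (p.1 ord0 i)| < p.2.+1%:R^-1].

Lemma rat_ball_basis U x : open U -> U x ->
  exists2 p, rat_ball p x & rat_ball p `<=` U.
Proof.
rewrite openE => /(_ x) Uo /Uo; rewrite /interior /= -nbhs_ballE.
move=> -[eps /= eps0 epsU].
pose m := Num.bound (2 / eps).
have meps : m.+1%:R^-1 < eps / 2.
  rewrite -[ltRHS]invf_div ltf_pV2 ?posrE ?divr_gt0//.
  apply: lt_trans (archi_boundP _) _; first by rewrite divr_ge0// ltW.
  by rewrite ltr_nat.
have m0 : 0 < m.+1%:R^-1 :> R by rewrite invr_gt0.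
have q i : {q : rat | `|x ord0 i - ratr q| < m.+1%:R^-1}.
  have /rat_in_itvoo/cid[q] : x ord0 i - m.+1%:R^-1 < x ord0 i + m.+1%:R^-1.
    by rewrite ltrBlDr -addrA ltrDl addr_gt0.
  rewrite in_itv/= => /andP[q1 q2]; exists q.
  by rewrite ltr_distlC q1 q2.
exists (\row_i sval (q i), m).
  by move=> i /=; rewrite mxE; exact: svalP (q i).
move=> y; rewrite /rat_ball/= => qy; apply: epsU; split => // i j.
rewrite (ord1 i) -ball_normE /=; have := qy j; rewrite mxE => qyj.
rewrite (splitr eps) (le_lt_trans (ler_distD (ratr (sval (q j))) _ _))//.
by rewrite ltrD// ?(distrC _ (y _ _)) (lt_trans _ meps)//; exact: svalP (q j).
Qed.

Lemma measurable_rat_ball p : measurable (rat_ball p).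
Proof.
rewrite (_ : rat_ball p = \bigcap_(i in [set: 'I_n])
    ((fun x => x ord0 i) @^-1` [set t | `|t - ratr (p.1 ord0 i)| < p.2.+1%:R^-1])).
  apply: fin_bigcap_measurable => // i _.
  rewrite -[X in measurable X]setTI; apply: measurable_coord => //.
  rewrite (_ : mkset _ = ball (ratr (p.1 ord0 i) : R) p.2.+1%:R^-1).
    exact: measurable_ball.
  by rewrite -ball_normE; apply/seteqP; split => t /=; rewrite distrC.
by apply/seteqP; split => [x h i _|x h i]; exact: h.
Qed.

Lemma open_rat_ballE U : open U ->
  U = \bigcup_(p in [set p | rat_ball p `<=` U]) rat_ball p.
Proof.
move=> Uo; apply/seteqP; split => [x Ux|x [p /= pU px]]; last exact: pU.
by have [p px pU] := rat_ball_basis Uo Ux; exists p.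
Qed.

Lemma open_measurable_rV U : open U -> measurable U.
Proof.
move=> Uo; rewrite (open_rat_ballE Uo) bigcup_mkcond.
apply: countable_bigcupT_measurable => [|p]; first exact: countableP.
by case: ifP => // _; exact: measurable_rat_ball.
Qed.

Lemma continuous_measurable_rV (f : 'rV[R]_n -> R) : continuous f ->
  measurable_fun setT f.
Proof.
move=> /continuousP fc; apply: (measurability _ (RGenOpens.measurableE R)).
move=> _ [_ [a [b ->] <-]]; rewrite setTI.
by apply: open_measurable_rV; apply: fc; exact: interval_open.
Qed.

Lemma compact_measurable_rV (K : set 'rV[R]_n) : compact K -> measurable K.
Proof.
move=> Kc; rewrite -(setCK K); apply: measurableC; apply: open_measurable_rV.
by apply: closed_openC; apply: compact_closed Kc; exact: norm_hausdorff.
Qed.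

(** Lindelöf argument: an arbitrary union of open sets is a union of countably many rational boxes,
    each contained in one of the sets. It is needed because [spt] is defined through an uncountable
    union. *)
Lemma ae_bigcup_open (mu : {measure set 'rV[R]_n -> \bar R}) (P : 'rV[R]_n -> Prop)
    (C : set (set 'rV[R]_n)) :
  (forall U, C U -> open U /\ {ae mu, forall x, U x -> P x}) ->
  {ae mu, forall x, (\bigcup_(U in C) U) x -> P x}.
Proof.
move=> Ch.
pose D := [set p | exists2 U, C U & rat_ball p `<=` U].
have Dcov : \bigcup_(U in C) U `<=` \bigcup_(p in D) rat_ball p.
  move=> x [U CU Ux]; have [Uo _] := Ch _ CU.
  by have [p px pU] := rat_ball_basis Uo Ux; exists p => //; exists U.
have h (p : 'rV[rat]_n * nat) : {ae mu, forall x, D p -> rat_ball p x -> P x}.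
  have [[U CU pU]|nD] := pselect (D p); last by apply: aeW.
  have [_] := Ch _ CU; apply: filterS => x Px _ /pU; exact: Px.
(* The boxes are enumerated by natural numbers; a number that encodes none imposes no condition. *)
have : {ae mu, forall x, forall k : nat,
    if @unpickle ('rV[rat]_n * nat)%type k is Some p
    then D p -> rat_ball p x -> P x else True}.
  apply/ae_foralln => k; case: unpickle => [p|]; [exact: h|exact: aeW].
apply: filterS => x Px /Dcov[p Dp px].
by have := Px (pickle p); rewrite pickleK; exact.
Qed.

End rV_topology_measure.

(** * Pairing of integrable functions with test functions *)

Section l1_pairing.
Context {d} {T : measurableType d} {R : realType} (mu : {measure set T -> \bar R}).
Implicit Types (u v w f g : T -> R).

Definition l1norm w : R := \int[mu]_x `|w x|.

Definition pairing w f : R := \int[mu]_x (w x * f x).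

Lemma integrable_mul_bounded w f B : mu.-integrable setT (EFin \o w) ->
  measurable_fun setT f -> (forall x, `|f x| <= B) ->
  mu.-integrable setT (EFin \o (fun x => w x * f x)).
Proof.
move=> iw mf fB; rewrite (_ : EFin \o _ = (EFin \o w) \* (EFin \o f))%E//.
apply: integrableMl => //; exists B; split; first by rewrite num_real.
by move=> y By x _; apply: le_trans (fB x) (ltW By).
Qed.

Lemma integral_norm w : mu.-integrable setT (EFin \o w) ->
  (\int[mu]_x `|w x|%:E)%E = (l1norm w)%:E.
Proof.
move=> iw; rewrite /l1norm /Rintegral fineK//; apply: integrable_fin_num => //.
exact: integrable_norm.
Qed.

Lemma l1norm_ge0 w : 0 <= l1norm w.
Proof. exact: Rintegral_ge0. Qed.

Lemma integrable_sub w v : mu.-integrable setT (EFin \o w) ->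
  mu.-integrable setT (EFin \o v) ->
  mu.-integrable setT (EFin \o (fun x => w x - v x)).
Proof.
move=> iw iv; rewrite (_ : _ \o _ = (EFin \o w) \- (EFin \o v))%E//.
exact: integrableB.
Qed.

Lemma pairingBr w f g B C : mu.-integrable setT (EFin \o w) ->
  measurable_fun setT f -> (forall x, `|f x| <= B) ->
  measurable_fun setT g -> (forall x, `|g x| <= C) ->
  pairing w (fun x => f x - g x) = pairing w f - pairing w g.
Proof.
move=> iw mf fB mg gC; rewrite /pairing -RintegralB//.
- by apply: eq_Rintegral => x _; rewrite mulrBr.
- exact: integrable_mul_bounded fB.
- exact: integrable_mul_bounded gC.
Qed.

Lemma pairingBl u v f B : mu.-integrable setT (EFin \o u) ->
  mu.-integrable setT (EFin \o v) ->
  measurable_fun setT f -> (forall x, `|f x| <= B) ->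
  pairing (fun x => u x - v x) f = pairing u f - pairing v f.
Proof.
move=> iu iv mf fB; rewrite /pairing -RintegralB//.
- by apply: eq_Rintegral => x _; rewrite mulrBl.
- exact: integrable_mul_bounded fB.
- exact: integrable_mul_bounded fB.
Qed.

Lemma pairing_le w f B : mu.-integrable setT (EFin \o w) ->
  measurable_fun setT f -> (forall x, `|f x| <= B) ->
  `|pairing w f| <= l1norm w * B.
Proof.
move=> iw mf fB; have iwf := integrable_mul_bounded iw mf fB.
apply: (le_trans (le_normr_Rintegral _ _)) => //.
rewrite mulrC -RintegralZl//; last exact: integrable_norm.
apply: le_Rintegral => //.
- exact: (integrable_norm iwf).
- rewrite (_ : _ \o _ = fun x => B%:E * `|w x|%:E)%E//; apply: integrableZl => //.
  exact: (integrable_norm iw).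
- by move=> x _; rewrite normrM mulrC ler_wpM2r.
Qed.

End l1_pairing.

(** * The variation as a bound on directional derivatives *)

Section variation.
Context {R : realType} {n : nat}.
Implicit Types (f F u w : 'rV[R]_n.+1 -> R) (g : 'I_n -> 'rV[R]_n.+1 -> R).
Implicit Types (x y : 'rV[R]_n.+1) (a L B : R).

Local Notation e i := (delta_mx ord0 i : 'rV[R]_n.+1).
Local Notation mu := (@lebesgue_rV R n.+1).

Lemma bounded_lipschitz_measurable f : bounded_lipschitz f ->
  measurable_fun setT f /\ exists B, forall x, `|f x| <= B.
Proof.
move=> [fB [L fL]]; split => //.
by apply: continuous_measurable_rV; exact: lipschitz_continuous fL.
Qed.

Lemma pairing_l1_functional (nu : {measure set 'rV[R]_n.+1 -> \bar R}) w :
  nu.-integrable setT (EFin \o w) -> l1_functional (l1norm nu w) (pairing nu w).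
Proof.
move=> iw; split.
  move=> f g /bounded_lipschitz_measurable[mf [B fB]].
  move=> /bounded_lipschitz_measurable[mg [C gC]].
  exact: pairingBr fB mg gC.
move=> f B /bounded_lipschitz_measurable[mf _] fB.
exact: pairing_le.
Qed.

Lemma enorm_gt0 x : x != 0 -> 0 < enorm x.
Proof.
move=> x0; rewrite lt_neqAle enorm_ge0 andbT; apply: contra_neq x0 => ex.
apply/rowP => i; rewrite mxE; apply/eqP; rewrite -normr_le0 ex.
exact: coord_le_enorm.
Qed.

Lemma Lipa_le a f B :
  (forall x y, `|f x - f y| <= B * enorm (x - y) `^ a) -> (Lipa a f <= B%:E)%E.
Proof.
move=> fB; apply: ge_ereal_sup => _ [x [y [xy ->]]].
rewrite lee_fin ler_pdivrMr//.
by rewrite powR_gt0// enorm_gt0// subr_eq0.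
Qed.

Lemma Lipa_ge0 a f : (0 <= Lipa a f)%E.
Proof.
apply: (@le_trans _ _ (`|f (e ord0) - f 0| / enorm (e ord0 - 0) `^ a)%:E).
  by rewrite lee_fin divr_ge0// powR_ge0.
apply: ereal_sup_ubound; exists (e ord0), 0; split => //.
by apply/eqP => /rowP/(_ ord0)/eqP; rewrite !mxE !eqxx oner_eq0.
Qed.

Lemma Lip_le f B : (forall x y, `|f x - f y| <= B * enorm (x - y)) ->
  (Lip f <= B%:E)%E.
Proof. by move=> fB; apply: Lipa_le => x y; rewrite powRr1 ?enorm_ge0. Qed.

Lemma Lip_coord (i : 'I_n.+1) : (Lip (fun x : 'rV[R]_n.+1 => x ord0 i) <= 1)%E.
Proof.
apply: Lip_le => x y; rewrite mul1r; have := coord_le_enorm (x - y) i.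
by rewrite !mxE.
Qed.

Lemma derive_coord (i j : 'I_n.+1) x :
  'D_(e j) (fun y : 'rV[R]_n.+1 => y ord0 i) x = (i == j)%:R.
Proof.
apply: (@derive_val _ _ _ _ _ _ _ _); apply/is_derive_lineP.
rewrite (_ : (fun _ => _) =
    (fun h : R => h * (i == j)%:R) + cst (x ord0 i)); last first.
  by apply/funext => h; rewrite !fctE !mxE eqxx.
rewrite -[X in is_derive _ _ _ X]addr0; apply: is_deriveD.
rewrite (_ : (fun h : R => _) = ((i == j)%:R : R) *: (id : R -> R)).
  by apply: is_derive_eq; exact: mulr1.
by apply/funext => h; rewrite !fctE mulrC.
Qed.

(** The coordinates other than the [i]-th do not depend on [x_i], so column [i] reduces to its entry
    in row 0, and the complementary minor is the identity. *)
Lemma det_Dmx_coord f (i : 'I_n.+1) x :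
  \det (Dmx f (fun k y => y ord0 (lift i k)) x) = (-1) ^+ i * 'D_(e i) f x.
Proof.
rewrite (expand_det_col _ i) big_ord_recl big1 ?addr0; last first.
  move=> k _; rewrite !mxE liftK derive_coord.
  by rewrite eq_sym (negbTE (neq_lift _ _)) mul0r.
rewrite !mxE unlift_none /= mulrC; congr (_ * _).
rewrite /cofactor add0n (_ : row' _ _ = 1%:M) ?det1 ?mulr1//.
by apply/matrixP => k l; rewrite !mxE liftK derive_coord (inj_eq (@lift_inj _ i)).
Qed.

(** The coordinates have Lipschitz constant at most 1, so their product drops out of the bound. The
    strict inequality supplies an admissible constant below [C] without going through the attainment
    of the infimum. *)
Lemma Valpha_holder_test a u C : (Valpha a u < C%:E)%E ->
  holder_test a C (pairing mu u).
Proof.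
move=> /ereal_inf_lt[C' [C'0 uC']] C'C i F L B FL dF B0 FB.
(* The sign of the cofactor is absorbed in the test function. *)
pose s : R := (-1) ^+ i.
have sN z : `|s * z| = `|z| by rewrite normrMsign.
have sL : coord_lipschitz L (fun x => s * F x).
  by move=> j x h; rewrite -mulrBr sN; exact: FL.
have sB x y : `|s * F x - s * F y| <= B * enorm (x - y) `^ a.
  by rewrite -mulrBr sN.
have Lf : (Lip (fun x => (s * F x)%R) < +oo)%E.
  apply: le_lt_trans (ltry (n.+1%:R * L)); apply: Lip_le => x y.
  exact: (lipschitz_enorm x y sL).
have := uC' (fun x => s * F x) (fun k y => y ord0 (lift i k)) Lf
  (fun k => le_lt_trans (Lip_coord _) (ltry _)).
have -> : (\int[mu]_x (u x * \det (Dmx (fun x => (s * F x)%R)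
    (fun k y => y ord0 (lift i k)) x))%:E =
    \int[mu]_x (u x * 'D_(e i) F x)%:E)%E.
  apply: eq_integral => x _; congr (_ * _)%:E; rewrite det_Dmx_coord.
  by rewrite (@deriveZ _ _ _ F s)// /GRing.scale/= mulrA -exprMn mulrNN mulr1 expr1n mul1r.
move=> uF; rewrite /pairing /Rintegral -lee_fin.
set I := (\int[mu]_x _)%E in uF *.
(* An infinite integral has [fine] value 0, so the inequality holds in every case. *)
apply: (@le_trans _ _ `|I|%E); first by case: I {uF} => //= *; rewrite ?lee_fin ?normr0 ?leey.
have /andP[P0 P1] : (0 <= \prod_(k < n) Lip (fun y : 'rV[R]_n.+1 => y ord0 (lift i k)) <= 1)%E.
  elim/big_ind: _ => [|p q /andP[p0 p1] /andP[q0 q1]|k _]; first by rewrite lee01 lexx.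
  - by rewrite mule_ge0//= -[leRHS]mule1 lee_pmul.
  - by rewrite Lipa_ge0 Lip_coord.
apply: (le_trans uF); rewrite EFinM -[leRHS]mule1.
apply: lee_pmul => //; first by rewrite mule_ge0// Lipa_ge0.
by apply: lee_pmul => //; [exact: Lipa_ge0|exact: ltW|exact: Lipa_le].
Qed.

End variation.

(** * Density of Lipschitz test functions *)

Lemma pairing_cvg0 {d} {T : measurableType d} {R : realType}
    (mu : {measure set T -> \bar R}) (w : T -> R) (f_ : nat -> T -> R) (B : R) :
  mu.-integrable setT (EFin \o w) ->
  (forall m, measurable_fun setT (f_ m)) -> (forall m x, `|f_ m x| <= B) ->
  (forall x, f_ m x @[m --> \oo] --> 0) ->
  pairing mu w (f_ m) @[m --> \oo] --> 0.
Proof.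
move=> iw mf fB f0.
have mw : measurable_fun setT w by apply/measurable_EFinP; exact: measurable_int iw.
have [|//||||_ _] := @dominated_convergence _ _ _ mu setT measurableT
    (fun m x => (w x * f_ m x)%:E) (cst 0%E) (fun x => B%:E * `|w x|%:E)%E.
- by move=> m; apply/measurable_EFinP; exact: measurable_funM.
- apply: aeW => x _; apply: cvg_EFin; first by near=> m.
  by rewrite -(mulr0 (w x)); apply: cvgMr; exact: f0.
- apply: integrableZl => //; exact: (integrable_norm iw).
- apply: aeW => x m _; rewrite lee_fin normrM mulrC ler_wpM2r//.
rewrite integral0 => h; rewrite /pairing /Rintegral.
exact: fine_cvg h.
Unshelve. all: by end_near. Qed.

Section lipschitz_density.
Context {R : realType} {n : nat}.
Variable mu : {measure set 'rV[R]_n.+1 -> \bar R}.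
Variable w : 'rV[R]_n.+1 -> R.
Hypothesis iw : mu.-integrable setT (EFin \o w).
Implicit Types (A : set 'rV[R]_n.+1) (f : 'rV[R]_n.+1 -> R).

Let nw := fun x => `|w x|.

Let inw : mu.-integrable setT (EFin \o nw).
Proof. exact: integrable_norm. Qed.

Let dist f g := pairing mu nw (fun x => `|f x - g x|).

(** Values in [0, 1] keep the class stable under [1 - f] and under products, which match complements
    and intersections. *)
Let unit_lipschitz f := (exists L, coord_lipschitz L f) /\ forall x, 0 <= f x <= 1.

Let unit_lipschitz_measurable f : unit_lipschitz f -> measurable_fun setT f.
Proof.
move=> [[L fL] _]; apply: continuous_measurable_rV.
exact: lipschitz_continuous fL.
Qed.

(* Indicators of such sets are limits of Lipschitz functions in L^1(|w| mu). They
   form a sigma-algebra containing the half-spaces. *)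
Definition lipschitz_approx A := measurable A /\
  forall eps, 0 < eps -> exists2 f, unit_lipschitz f & dist \1_A f <= eps.

Let unit f := measurable_fun setT f /\ forall x, 0 <= f x <= 1.

Let unit_indic A : measurable A -> unit \1_A.
Proof.
move=> mA; split; first exact: measurable_indic.
by move=> x; rewrite indicE ler0n lern1 leq_b1.
Qed.

Let unit_lip f : unit_lipschitz f -> unit f.
Proof. by move=> lf; split; [exact: unit_lipschitz_measurable|case: lf]. Qed.

Let unit_dist f g : unit f -> unit g ->
  measurable_fun setT (fun x => `|f x - g x|) /\ forall x, `| `|f x - g x| | <= 1.
Proof.
move=> [mf f1] [mg g1]; split.
  by apply: measurableT_comp => //; exact: measurable_funB.
move=> x; rewrite normr_id ler_norml.
have /andP[? ?] := f1 x; have /andP[? ?] := g1 x; lra.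
Qed.

Let integrable_dist f g : unit f -> unit g ->
  mu.-integrable setT (EFin \o (fun x => nw x * `|f x - g x|)).
Proof.
by move=> uf ug; have [m b] := unit_dist uf ug; exact: integrable_mul_bounded b.
Qed.

Let le_dist f g h k : unit f -> unit g -> unit h -> unit k ->
  (forall x, `|f x - g x| <= `|h x - k x|) -> dist f g <= dist h k.
Proof.
move=> uf ug uh uk fghk; apply: le_Rintegral => //.
- exact: integrable_dist.
- exact: integrable_dist.
- by move=> x _; rewrite /nw ler_wpM2l.
Qed.

Let le_distD f g h k p q : unit f -> unit g -> unit h -> unit k -> unit p -> unit q ->
  (forall x, `|f x - g x| <= `|h x - k x| + `|p x - q x|) ->
  dist f g <= dist h k + dist p q.
Proof.
move=> uf ug uh uk up uq le; rewrite /dist /pairing -RintegralD//; last 2 first.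
- exact: integrable_dist.
- exact: integrable_dist.
apply: le_Rintegral => //.
- exact: integrable_dist.
- rewrite (_ : _ \o _ = (EFin \o (fun x => nw x * `|h x - k x|)%R) \+
     (EFin \o (fun x => nw x * `|p x - q x|)%R))%E//.
  by apply: integrableD => //; exact: integrable_dist.
- by move=> x _; rewrite -mulrDr /nw ler_wpM2l.
Qed.

Let dist_cvg f (f_ : nat -> 'rV[R]_n.+1 -> R) (eps : R) : 0 < eps ->
  unit f -> (forall m, unit (f_ m)) ->
  (forall x, f_ m x @[m --> \oo] --> f x) -> exists m, dist f (f_ m) <= eps.
Proof.
move=> eps0 uf uf_ ff.
have : dist f (f_ m) @[m --> \oo] --> 0.
  apply: (pairing_cvg0 inw (B := 1)).
  - by move=> m; have [] := unit_dist uf (uf_ m).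
  - by move=> m; have [] := unit_dist uf (uf_ m).
  - move=> x; rewrite -(normr0 R) -(subrr (f x)); apply: cvg_norm.
    by apply: cvgB; [exact: cvg_cst|exact: ff].
move=> /cvgrPdist_le /(_ eps eps0)[m _ /(_ m (leqnn m))] /=.
rewrite sub0r normrN ger0_norm; first by exists m.
by apply: Rintegral_ge0 => x _; rewrite /nw mulr_ge0.
Qed.

Let approxC A : lipschitz_approx A -> lipschitz_approx (~` A).
Proof.
move=> [mA hA]; split; first exact: measurableC.
move=> eps /hA[f uf Af]; pose f' x := 1 - f x.
have uf' : unit_lipschitz f'.
  case: uf => [[L fL] f01]; split.
    exists L => i x h; rewrite /f' opprB addrC addrA subrK distrC; exact: fL.
  by move=> x; rewrite /f'; have /andP[? ?] := f01 x; lra.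
exists f' => //; apply: le_trans Af; apply: le_dist.
- exact/unit_indic/measurableC.
- exact: unit_lip.
- exact: unit_indic.
- exact: unit_lip.
- move=> x; rewrite !indicE in_setC /f'; case: (x \in A) => /=.
    by rewrite sub0r normrN.
  by rewrite opprB addrC subrK sub0r normrN.
Qed.

Let approxI A B : lipschitz_approx A -> lipschitz_approx B ->
  lipschitz_approx (A `&` B).
Proof.
move=> [mA hA] [mB hB]; split; first exact: measurableI.
move=> eps eps0; have eps20 : 0 < eps / 2 by rewrite divr_gt0.
have [f uf Af] := hA _ eps20; have [g ug Bg] := hB _ eps20.
have ufg : unit_lipschitz (fun x => f x * g x).
  case: uf => -[L fL] f01; case: ug => -[M gM] g01; split; last first.
    move=> x; have /andP[? ?] := f01 x; have /andP[? ?] := g01 x.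
    by rewrite mulr_ge0//= mulr_ile1.
  exists (L + M) => i x h.
  set y := x + _; rewrite -(subrK (f x * g y) (f y * g y)) -addrA -mulrBl -mulrBr.
  rewrite (le_trans (ler_normD _ _))// (mulrDl L) (normrM _ (g y)) normrM lerD//.
    apply: le_trans (fL i x h); rewrite ler_piMr// ger0_norm;
      by have /andP[? ?] := g01 y.
  apply: le_trans (gM i x h); rewrite ler_piMl// ger0_norm;
    by have /andP[? ?] := f01 x.
exists (fun x => f x * g x) => //.
rewrite (splitr eps) (le_trans _ (lerD Af Bg))//.
have uA := unit_indic mA; have uB := unit_indic mB.
apply: le_distD; rewrite ?(unit_lip uf) ?(unit_lip ug)//; do ?exact: unit_lip.
  exact/unit_indic/measurableI.
move=> x; rewrite indicI /=.
rewrite -(subrK (f x * \1_B x) (\1_A x * \1_B x)) -addrA -mulrBl -mulrBr.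
rewrite (le_trans (ler_normD _ _))// !normrM lerD//.
  by rewrite ler_piMr// ger0_norm; have [_ /(_ x)/andP[? ?]] := uB.
by rewrite ler_piMl// ger0_norm; case: uf => _ /(_ x)/andP[? ?].
Qed.

Let clamp (t : R) : R := Num.min 1 (Num.max 0 t).

Let clamp_ge0 t : 0 <= clamp t.
Proof. by rewrite /clamp le_min ler01 le_max lexx. Qed.

Let clamp_le1 t : clamp t <= 1.
Proof. by rewrite /clamp ge_min lexx. Qed.

Let clamp_dist s t : `|clamp s - clamp t| <= `|s - t|.
Proof.
have key a b : a <= b -> `|clamp a - clamp b| <= `|a - b|.
  move=> ab; rewrite distrC (distrC a) (ger0_norm (_ : 0 <= b - a)) ?subr_ge0//.
  rewrite /clamp /Num.min /Num.max; do !case: ifP; rewrite ler_norml => *; lra.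
by have [/key//|/ltW/key] := leP s t; rewrite distrC (distrC t).
Qed.

(** At each point the ramps [clamp (m * (c - x_i))] are eventually equal to the indicator, also on
    the hyperplane [x_i = c], where both vanish. *)
Let approx_halfspace i (c : R) : lipschitz_approx [set x | x ord0 i < c].
Proof.
have mA : measurable [set x : 'rV[R]_n.+1 | x ord0 i < c].
  rewrite (_ : mkset _ = (fun x : 'rV[R]_n.+1 => x ord0 i) @^-1` `]-oo, c[).
    by rewrite -[X in measurable X]setTI; apply: measurable_coord => //; exact: measurable_itv.
  by apply/seteqP; split => x /=; rewrite in_itv.
split => // eps eps0.
pose f (m : nat) (x : 'rV[R]_n.+1) := clamp (m%:R * (c - x ord0 i)).
have uf m : unit_lipschitz (f m).
  split; last by move=> x; rewrite clamp_ge0 clamp_le1.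
  exists m%:R => j x h; apply: (le_trans (clamp_dist _ _)).
  rewrite -mulrBr normrM ger0_norm// ler_wpM2l// !mxE.
  rewrite (_ : c - _ - _ = - (h * ((ord0 == ord0 :> 'I_1) && (i == j))%:R)); last by ring.
  rewrite normrN normrM ler_piMr//.
  by rewrite ger0_norm// lern1 leq_b1.
have [m fm] : exists m, dist \1_[set x | x ord0 i < c] (f m) <= eps.
  apply: dist_cvg => //; first exact: unit_indic.
    by move=> m; exact: unit_lip.
  move=> x; apply: cvg_near_cst; have [xc|xc] := ltP (x ord0 i) c; last first.
    near=> m; rewrite indicE memNset /=; last by apply/negP; rewrite -leNgt.
    rewrite /f /clamp max_l ?min_r//.
    by rewrite mulr_ge0_le0// subr_le0.
  near=> m; rewrite indicE mem_set// /f /clamp min_l//.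
  rewrite le_max -ler_pdivrMr ?subr_gt0//; apply/orP; right.
  by near: m; exact: nbhs_infty_ger.
by exists (f m).
Unshelve. all: by end_near. Qed.

Let approx0 : lipschitz_approx set0.
Proof.
rewrite -(setICr [set x : 'rV[R]_n.+1 | x ord0 ord0 < 0]).
by apply: approxI; last apply: approxC; exact: approx_halfspace.
Qed.

(** Finite unions come from complements and intersections; they converge to the countable union by
    dominated convergence. *)
Let approx_bigcup (A : nat -> set 'rV[R]_n.+1) :
  (forall k, lipschitz_approx (A k)) -> lipschitz_approx (\bigcup_k A k).
Proof.
move=> hA; have mA k : measurable (A k) by have [] := hA k.
split; first exact: bigcupT_measurable.
have hfin m : lipschitz_approx (\bigcup_(k < m) A k).
  elim: m => [|m IH].
    by rewrite bigcup_mkord big_ord0; exact: approx0.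
  rewrite bigcup_mkord big_ord_recr /= -bigcup_mkord.
  by rewrite -[X in lipschitz_approx X]setCK setCU; apply: approxC; apply: approxI; exact: approxC.
move=> eps eps0; have eps20 : 0 < eps / 2 by rewrite divr_gt0.
have mfin m : measurable (\bigcup_(k < m) A k) by have [] := hfin m.
have [m Am] : exists m, dist \1_(\bigcup_k A k) \1_(\bigcup_(k < m) A k) <= eps / 2.
  apply: dist_cvg => //.
  - exact/unit_indic/bigcupT_measurable.
  - by move=> m; exact: unit_indic.
  - move=> x; apply: cvg_near_cst.
    have [[k _ Akx]|nA] := pselect ((\bigcup_k A k) x).
      near=> m; rewrite !indicE !mem_set//; first by exists k.
      by exists k => //=; near: m; exact: nbhs_infty_gt.
    near=> m; rewrite !indicE !memNset// => -[k _ Akx]; apply: nA; exists k => //.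
have [_ /(_ _ eps20)[f uf mf]] := hfin m.
exists f => //; rewrite (splitr eps) (le_trans _ (lerD Am mf))//.
apply: le_distD; do ?[exact: unit_lip|exact: unit_indic].
- exact/unit_indic/bigcupT_measurable.
- exact/unit_indic/bigcupT_measurable.
- by move=> x; exact: ler_distD.
Unshelve. all: by end_near. Qed.

Lemma measurable_lipschitz_approx A : measurable A -> lipschitz_approx A.
Proof.
move=> mA; suff : [set B | lipschitz_approx B] A by [].
apply: (mA [set B | lipschitz_approx B]); split.
  split => [//|B hB|F hF] /=; [by rewrite setTD; exact: approxC|exact: approx_bigcup].
rewrite -bigcup_mkord_ord; apply: bigcup_sub => i _ _ [B mB <-] /=; rewrite setTI.
suff : [set B | lipschitz_approx ((fun x : 'rV[R]_n.+1 => x ord0 (inord i)) @^-1` B)] B by [].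
(* A second induction, inside one coordinate: the Borel sets of the line are generated by the rays
   []-oo, c[]. *)
have := mB; rewrite [X in X B -> _](_ : _ = (@RGenInftyO.G R).-sigma.-measurable); last first.
  exact: RGenInftyO.measurableE.
apply; split.
  split => [|C|F hF] /=; first by rewrite preimage_set0.
  - by rewrite setTD preimage_setC; exact: approxC.
  - by rewrite preimage_bigcup; exact: approx_bigcup.
by move=> _ [c ->]; have := approx_halfspace (inord i) c; congr lipschitz_approx.
Qed.

(** The sign of [w] is twice the indicator of [w >= 0] minus 1; a Lipschitz approximation [g] of
    this indicator gives [f]. *)
Lemma lipschitz_dual (eps : R) : 0 < eps -> exists f, [/\ forall x, `|f x| <= 1,
  exists L, coord_lipschitz L f & l1norm mu w <= pairing mu w f + eps].
Proof.
move=> eps0; have eps20 : 0 < eps / 2 by rewrite divr_gt0.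
have mw : measurable_fun setT w by apply/measurable_EFinP; exact: measurable_int iw.
have mA : measurable [set x | 0 <= w x].
  rewrite (_ : mkset _ = w @^-1` `[0, +oo[).
    by rewrite -[X in measurable X]setTI; apply: mw => //; exact: measurable_itv.
  by apply/seteqP; split => x /=; rewrite in_itv /= andbT.
have [_ /(_ _ eps20)[g ug Ag]] := measurable_lipschitz_approx mA.
have [mg g01] := unit_lip ug.
pose f x := 2 * g x - 1.
have f1 x : `|f x| <= 1 by rewrite ler_norml /f; have /andP[? ?] := g01 x; lra.
have mf : measurable_fun setT f.
  by apply: measurable_funB => //; exact: measurable_funM.
exists f; split => //.
  case: ug => -[L gL] _; exists (2 * L) => i x h.
  rewrite /f opprB addrA subrK -mulrBr normrM ger0_norm// -mulrA ler_wpM2l//.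
  exact: gL.
rewrite -lerBlDl (le_trans _ (_ : 2 * dist \1_[set x | 0 <= w x] g <= _))//; last first.
  by rewrite mulrC -ler_pdivlMr.
have uA := unit_indic mA; have ug' := unit_lip ug.
rewrite /l1norm /pairing -RintegralB//; last exact: integrable_mul_bounded f1.
rewrite /dist /pairing -RintegralZl//; last exact: integrable_dist.
apply: le_Rintegral => //.
- apply: (integrable_sub (w := fun x => `|w x|)) => //; exact: integrable_mul_bounded f1.
- rewrite (_ : _ \o _ = fun x => 2%:E * (nw x * `|\1_[set x | 0 <= w x] x - g x|)%:E)%E//.
  by apply: integrableZl => //; exact: integrable_dist.
(* For either sign of [w] the two sides are equal. *)
move=> x _; rewrite /nw /f indicE; have /andP[g0 g1] := g01 x.
have [w0|w0] := leP 0 (w x).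
  rewrite mem_set//= (ger0_norm (_ : 0 <= 1 - g x)) ?subr_ge0// (ger0_norm w0).
  by rewrite le_eqVlt; apply/orP; left; apply/eqP; ring.
rewrite memNset; last by rewrite /= leNgt w0.
rewrite sub0r normrN (ger0_norm g0) (ltr0_norm w0).
by rewrite le_eqVlt; apply/orP; left; apply/eqP; ring.
Qed.

End lipschitz_density.

(** * Measurability of partial derivatives *)

Section derivative_measurable.
Context {R : realType} {n : nat}.
Implicit Types (f : 'rV[R]_n.+1 -> R) (v x : 'rV[R]_n.+1) (h L : R).

Let dq f v h x : R := h^-1 *: (f (h *: v + x) - f x).

Let punctured (k : nat) h := 0 < `|h| < k.+1%:R^-1.

(* By continuity in h, rational steps suffice in the Cauchy criterion for the
   existence of the derivative; this makes it a countable condition. *)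
Let rat_cauchy f v x := forall m : nat, exists k : nat, forall pq : rat * rat,
  punctured k (ratr pq.1) && punctured k (ratr pq.2) ->
  `|dq f v (ratr pq.1) x - dq f v (ratr pq.2) x| <= m.+1%:R^-1.

Let dq_continuous f v x L h : coord_lipschitz L f -> h != 0 ->
  {for h, continuous (fun t => dq f v t x)}.
Proof.
move=> fL h0; apply: cvgM; first exact: cvgV.
apply: cvgB; last exact: cvg_cst.
apply: continuous_comp; last exact: lipschitz_continuous fL _.
apply: cvgD; last exact: cvg_cst.
exact: scalel_continuous.
Qed.

(** A rational step [q] close to [h] stays in the punctured interval and has nearly the same
    quotient. One of the two steps may remain rational, as it will be the fixed centre of a Cauchy
    ball. *)
Let punctured_cauchy f v x L (k m : nat) h (p : rat) : coord_lipschitz L f ->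
  (forall pq : rat * rat, punctured k (ratr pq.1) && punctured k (ratr pq.2) ->
   `|dq f v (ratr pq.1) x - dq f v (ratr pq.2) x| <= m.+1%:R^-1) ->
  punctured k h -> punctured k (ratr p) ->
  `|dq f v h x - dq f v (ratr p) x| <= m.+1%:R^-1.
Proof.
move=> fL fk hk pk; have /andP[h0 hk1] := hk.
apply/ler_addgt0Pr => eta eta0.
have hn0 : h != 0 by rewrite -normr_gt0.
have near1 : \forall t \near h, `|dq f v h x - dq f v t x| < eta.
  by have /cvgrPdist_lt := @dq_continuous f v x L h fL hn0; exact.
have near2 : \forall t \near h, punctured k t.
  have tcont : {for h, continuous (fun t : R => `|t|)} by exact: norm_continuous.
  near=> t; apply/andP; split.
    by near: t; exact: (cvgr_gt `|h|).
  by near: t; exact: (cvgr_lt `|h|).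
have /nbhs_ballP[r /= r0 hr] : \forall t \near h,
    `|dq f v h x - dq f v t x| < eta /\ punctured k t.
  by apply: filterS2 near1 near2 => t.
have /rat_in_itvoo[q] : h - r < h + r by lra.
rewrite in_itv/= => /andP[q1 q2].
have [hq qk] : `|dq f v h x - dq f v (ratr q) x| < eta /\ punctured k (ratr q).
  by apply: hr; rewrite -ball_normE /= ltr_distlC; apply/andP; split.
rewrite (le_trans (ler_distD (dq f v (ratr q) x) _ _))// addrC lerD ?(ltW hq)//.
by apply: (fk (q, p)); rewrite qk pk.
Unshelve. all: by end_near. Qed.

Let derivable_rat_cauchy f v x L : coord_lipschitz L f ->
  derivable f x v <-> rat_cauchy f v x.
Proof.
move=> fL; split.
  move=> /cvg_ex[/= l /cvgrPdist_lt fl] m.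
  have m20 : 0 < m.+1%:R^-1 / 2 :> R by rewrite divr_gt0.
  have := fl _ m20; rewrite near_withinE => /nbhs_ballP[r /= r0 rl].
  exists (Num.bound r^-1) => -[p q] /= /andP[/andP[p0 pr] /andP[q0 qr]].
  have kr : (Num.bound r^-1).+1%:R^-1 < r.
    rewrite invf_plt ?posrE//; apply: lt_trans (archi_boundP _) _.
      by rewrite invr_ge0 ltW.
    by rewrite ltr_nat.
  have near_l (h : R) : 0 < `|h| -> `|h| < r -> `|l - dq f v h x| < m.+1%:R^-1 / 2.
    move=> h0 hr; apply: rl; first by rewrite -ball_normE /= sub0r normrN.
    by rewrite -normr_gt0.
  rewrite (splitr _^-1) (le_trans (ler_distD l _ _))// lerD//.
    by rewrite distrC ltW// near_l// (lt_trans pr).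
  by rewrite ltW// near_l// (lt_trans qr).
move=> fc; apply/cauchy_cvgP/cauchy_exP => eps /= eps0.
pose m := Num.bound eps^-1.
have meps : m.+1%:R^-1 < eps.
  rewrite invf_plt ?posrE//; apply: lt_trans (archi_boundP _) _.
    by rewrite invr_ge0 ltW.
  by rewrite ltr_nat.
have [k fk] := fc m.
(* [1 / (k + 2)] is a rational step inside the punctured interval; its quotient is the centre of the
   Cauchy ball. *)
have pk : punctured k (ratr (k.+2%:R^-1)).
  rewrite /punctured fmorphV rmorph_nat ger0_norm ?invr_ge0// invr_gt0 ltr0n/=.
  by rewrite ltf_pV2 ?posrE// ltr_nat.
exists (dq f v (ratr k.+2%:R^-1) x).
suff : \forall h \near 0^', ball (dq f v (ratr k.+2%:R^-1) x) eps (dq f v h x).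
  by [].
rewrite near_withinE; apply/nbhs_ballP.
exists k.+1%:R^-1 => /=; first by rewrite invr_gt0.
move=> h; rewrite -!ball_normE /= sub0r normrN => hk h0.
rewrite distrC; apply: le_lt_trans meps; apply: punctured_cauchy fL fk _ pk.
by rewrite /punctured normr_gt0 h0.
Qed.

Let dq_measurable f v h L : coord_lipschitz L f -> measurable_fun setT (dq f v h).
Proof.
move=> fL; apply: measurable_funM => //; apply: measurable_funB.
  apply: continuous_measurable_rV.
  apply: (@lipschitz_continuous _ _ L) => i x t.
  by rewrite addrA; exact: fL.
by apply: continuous_measurable_rV; exact: lipschitz_continuous fL.
Qed.

Let derivable_measurable f v L : coord_lipschitz L f ->
  measurable [set x | derivable f x v].
Proof.
move=> fL.
rewrite (_ : mkset _ = \bigcap_m \bigcup_k ~` \bigcup_(pq : rat * rat) ~`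
   [set x | punctured k (ratr pq.1) && punctured k (ratr pq.2) ->
   `|dq f v (ratr pq.1) x - dq f v (ratr pq.2) x| <= m.+1%:R^-1]).
  apply: bigcapT_measurable => m; apply: bigcupT_measurable => k.
  apply: measurableC; apply: countable_bigcupT_measurable => [|pq].
    exact: countableP.
  apply: measurableC.
  have [pk|npk] := boolP (punctured k (ratr pq.1) && punctured k (ratr pq.2)); last first.
    by rewrite (_ : mkset _ = setT)//; apply/seteqP; split.
  rewrite (_ : mkset _ = (fun x => `|dq f v (ratr pq.1) x - dq f v (ratr pq.2) x|)
      @^-1` `]-oo, m.+1%:R^-1]).
    rewrite -[X in measurable X]setTI.
    suff : measurable_fun setT
        (fun x => `|dq f v (ratr pq.1) x - dq f v (ratr pq.2) x|).
      by apply => //; exact: measurable_itv.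
    apply: measurableT_comp => //.
    by apply: measurable_funB; exact: dq_measurable fL.
  by apply/seteqP; split => x /=; rewrite in_itv/=; [exact|].
apply/seteqP; split => x /=.
  move=> /(derivable_rat_cauchy _ _ fL) fc m _; have [k fk] := fc m.
  by exists k => //= -[pq _]; apply; exact: fk.
move=> h; apply/(derivable_rat_cauchy _ _ fL) => m; have [k _ fk] := h m I.
exists k => pq pqk; apply: contrapT => npq; apply: fk; exists pq => //= H.
exact/npq/H.
Qed.

(** Where the derivative exists it is the limit along the steps [1 / (k + 1)]; elsewhere it has the
    constant default value. Both pieces are measurable, so differentiability almost everywhere is
    not invoked. *)
Lemma lipschitz_derive_measurable f v L : coord_lipschitz L f ->
  measurable_fun setT ('D_v f).
Proof.
move=> fL.
pose g x := fine (limn_esup (fun k => (dq f v k.+1%:R^-1 x)%:E)).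
have mg : measurable_fun setT g.
  apply: (measurableT_comp (fine_measurable measurableT)).
  apply: measurable_fun_limn_esup => k.
  by apply/measurable_EFinP; exact: dq_measurable fL.
rewrite (_ : 'D_v f = fun x => if `[< derivable f x v >] then g x else point).
  apply: measurable_fun_ifT => //; apply: (measurable_fun_bool true).
  rewrite setTI (_ : _ @^-1` _ = [set x | derivable f x v]).
    exact: derivable_measurable fL.
  by apply/seteqP; split => x /=; [move/asboolP|move=> ?; apply/asboolP].
apply/funext => x; case: asboolP => [fx|]; last exact: dvgP.
rewrite /g (_ : limn_esup _ = ('D_v f x)%:E)//.
apply: (cvg_limn_einf_sup _).2; apply: cvg_EFin; first by near=> k.
have Dx : dq f v h x @[h --> 0^'] --> 'D_v f x by exact: fx.
apply: cvg_comp Dx => A; rewrite /dnbhs /within /= => /cvg_harmonic.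
by apply: (@filterS _ \oo) => k; apply; rewrite invr_neq0.
Unshelve. all: by end_near. Qed.

(* The bound covers the default value of the derivative where it does not exist. *)
Lemma lipschitz_derive_bounded f i L : coord_lipschitz L f ->
  exists B, forall x, `|'D_(delta_mx ord0 i) f x| <= B.
Proof.
move=> fL; exists (Num.max L `|point : R|) => x; rewrite le_max.
have [fx|nfx] := pselect (derivable f x (delta_mx ord0 i)); last first.
  by apply/orP; right; rewrite /derive dvgP.
apply/orP; left.
have Dx : `|dq f (delta_mx ord0 i) h x| @[h --> 0^'] --> `|'D_(delta_mx ord0 i) f x|.
  by apply: cvg_norm; exact: fx.
apply: (cvgr_to_le Dx); near=> h.
have h0 : h != 0 by near: h; exact: nbhs_dnbhs_neq.
rewrite /dq normrM normfV ler_pdivrMl ?normr_gt0// [leRHS]mulrC (addrC (_ *: _)).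
exact: fL.
Unshelve. all: by end_near. Qed.

End derivative_measurable.

(** * Compactness *)

Section ultrafilter_cauchy.
Context {T : Type} {R : realType} (G : set_system T) {GU : UltraFilter G}.

Lemma fmap_ultra (U : Type) (f : T -> U) : UltraFilter (f @ G).
Proof.
split; first exact: fmap_proper_filter.
move=> H HF GH; apply/predeqP => B; split => [HB|]; last exact: GH.
have [//|GB] := in_ultra_setVsetC (f @^-1` B) GU.
have HBC : H (~` B) by apply: GH; rewrite /fmap /= preimage_setC.
have [x [Bx nBx]] := filter_ex (filterI HB HBC).
by have := nBx Bx.
Qed.

(** The image ultrafilter contains a compact segment and hence converges to a point of it. *)
Lemma ultra_bounded_cauchy (t : T -> R) (M eps : R) : (forall k, `|t k| <= M) ->
  0 < eps -> exists2 A, G A & forall k l, A k -> A l -> `|t k - t l| <= eps.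
Proof.
move=> tM eps0; have tG := fmap_ultra t.
have := @segment_compact R (- M) M; rewrite compact_ultra => /(_ _ tG).
have tGM : (t @ G) `[(- M), M]%classic.
  apply: (@filterE _ G) => k; rewrite /= in_itv/= -ler_norml; exact: tM.
move=> /(_ tGM)[p [_ /cvgrPdist_le/(_ (eps / 2))]].
rewrite divr_gt0// => /(_ isT) Gp.
exists [set k | `|p - t k| <= eps / 2]; first exact: Gp.
move=> k l /= pk pl; rewrite (splitr eps).
by rewrite (le_trans (ler_distD p _ _))// lerD// distrC.
Qed.

Lemma ultra_bounded_cauchy_seq (N : nat) (t : nat -> T -> R) (M eps : R) :
  (forall j k, `|t j k| <= M) -> 0 < eps ->
  exists2 A, G A & forall k l, A k -> A l ->
    forall j, (j < N)%N -> `|t j k - t j l| <= eps.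
Proof.
move=> tM eps0; elim: N => [|N [A GA hA]].
  by exists setT => //; exact: filterT.
have [B GB hB] := ultra_bounded_cauchy (tM N) eps0.
exists (A `&` B); first exact: filterI.
move=> k l [Ak Bk] [Al Bl] j; rewrite ltnS leq_eqVlt => /predU1P[->|jN].
  exact: hB.
exact: hA.
Qed.

End ultrafilter_cauchy.

(** * Step functions subordinate to a partition of a compact set *)

Section step_approximation.
Context {R : realType} {n : nat}.
Variable mu : {measure set 'rV[R]_n.+1 -> \bar R}.
Implicit Types (w g : 'rV[R]_n.+1 -> R) (K : set 'rV[R]_n.+1) (L : R).

Lemma compact_partition K (delta : R) : compact K -> 0 < delta ->
  exists N (p : nat -> 'rV[R]_n.+1) (Q : nat -> set 'rV[R]_n.+1),
  [/\ forall j, measurable (Q j), trivIset setT Q,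
    K `<=` \bigcup_(j < N) Q j & forall j x, Q j x -> `|x - p j| < delta].
Proof.
rewrite compact_cover => Kc d0.
have [|x Kx|D _ KD] := Kc _ K (fun x => ball x delta).
- by move=> x _; apply: ball_open.
- by exists x => //; exact: ballxx.
(* Past the end of the list the centre is 0, so measurability and the diameter bound hold for every
   index. *)
pose p := nth 0 (finmap.enum_fset D).
pose F j := ball (p j) delta.
exists (size (finmap.enum_fset D)), p, (seqDU F); split.
- apply: seqDU_measurable => j; apply: open_measurable_rV; exact: ball_open.
- exact: trivIset_seqDU.
- rewrite bigcup_mkord -bigsetU_seqDU -bigcup_mkord => x /KD[y /= yD yx].
  exists (index y (finmap.enum_fset D)); first by rewrite /= index_mem.
  by rewrite /F /p nth_index.
- move=> j x /(@subset_seqDU _ F); rewrite /F -ball_normE /= distrC; exact.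
Qed.

Lemma pairing_step w (N : nat) (c : nat -> R) (Q : nat -> set 'rV[R]_n.+1) :
  mu.-integrable setT (EFin \o w) -> (forall j, measurable (Q j)) ->
  (forall j, `|c j| <= 1) ->
  let g := fun x => \sum_(j < N) c j * \1_(Q j) x in
  [/\ measurable_fun setT g, forall x, `|g x| <= N%:R &
      `|pairing mu w g| <= \sum_(j < N) `|pairing mu w \1_(Q j)| ].
Proof.
move=> iw mQ c1; elim: N => [|N [mg gN IH]] g.
  have -> : g = fun=> 0 by apply/funext => x; rewrite /g big_ord0.
  split; [exact: measurable_cst|by move=> x; rewrite normr0|].
  rewrite big_ord0 normr_le0; apply/eqP; rewrite /pairing.
  by under eq_Rintegral do rewrite mulr0; rewrite Rintegral_cst// mul0r.
pose g0 x := \sum_(j < N) c j * \1_(Q j) x.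
(* The new term is subtracted with the opposite sign so that [pairingBr] applies. *)
pose h x := - c N * \1_(Q N) x.
have gE : g = fun x => g0 x - h x.
  by apply/funext => x; rewrite /g big_ord_recr/= /h mulNr opprK.
have mh : measurable_fun setT h.
  by apply: measurable_funM => //; exact: measurable_indic.
have h1 x : `|h x| <= 1.
  rewrite /h normrM normrN mulr_ile1// ger0_norm// indicE ?lern1 ?leq_b1//.
rewrite gE; split.
- exact: measurable_funB.
- by move=> x; rewrite -natr1 (le_trans (ler_normB _ _))// lerD// gN.
rewrite (pairingBr iw mg gN mh h1) big_ord_recr/=.
rewrite (le_trans (ler_normB _ _))// lerD//.
have -> : pairing mu w h = - c N * pairing mu w \1_(Q N).
  rewrite /pairing -RintegralZl//.
    by apply: eq_Rintegral => x _; rewrite /h mulrCA.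
  have mi : measurable_fun setT (\1_(Q N) : 'rV[R]_n.+1 -> R) by exact: measurable_indic.
  apply: (integrable_mul_bounded iw mi (B := 1)) => x.
  by rewrite ger0_norm// indicE lern1 leq_b1.
by rewrite normrM normrN ler_piMl.
Qed.

(** [g] is replaced by its value at [p j] on each [Q j]; the error is its oscillation on a cell, and
    [w] vanishes off the cells. *)
Lemma pairing_lipschitz_le w g K L delta (N : nat) (p : nat -> 'rV[R]_n.+1)
    (Q : nat -> set 'rV[R]_n.+1) :
  0 <= delta -> mu.-integrable setT (EFin \o w) -> measurable K -> (forall x, ~ K x -> w x = 0) ->
  coord_lipschitz L g -> (forall x, `|g x| <= 1) ->
  (forall j, measurable (Q j)) -> trivIset setT Q ->
  K `<=` \bigcup_(j < N) Q j -> (forall j x, Q j x -> `|x - p j| < delta) ->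
  `|pairing mu w g| <= l1norm mu w * (n.+1%:R * L * delta) +
    \sum_(j < N) `|pairing mu w \1_(Q j)|.
Proof.
move=> d0 iw mK wK gL g1 mQ tQ KQ Qp.
have [ms sN sle] := pairing_step N iw mQ (fun j => g1 (p j)).
set s := fun x => _ in ms sN sle.
have mg : measurable_fun setT g.
  by apply: continuous_measurable_rV; exact: lipschitz_continuous gL.
rewrite -(subrK (pairing mu w s) (pairing mu w g)).
rewrite (le_trans (ler_normD _ _))// lerD//.
rewrite -(pairingBr iw mg g1 ms sN).
(* The step function is close to [g] on [K] only; the indicator makes the bound hold everywhere
   without changing the pairing. *)
pose h x := \1_K x * (g x - s x).
rewrite (_ : pairing mu w _ = pairing mu w h); last first.
  apply: eq_Rintegral => x _; rewrite /h indicE.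
  have [xK|xK] := boolP (x \in K); first by rewrite mul1r.
  by rewrite wK ?mul0r//; move/negP: xK; rewrite inE.
apply: pairing_le => //.
  by apply: measurable_funM; [exact: measurable_indic|exact: measurable_funB].
move=> x; rewrite /h indicE; have L0 := lipschitz_ge0 gL.
have [|xK] := boolP (x \in K); last first.
  by rewrite mul0r normr0 !mulr_ge0.
rewrite inE => /KQ[j /= jN Qx]; rewrite mul1r.
have -> : s x = g (p j).
  rewrite /s (bigD1 (Ordinal jN))//= indicE mem_set// mulr1 big1 ?addr0// => i ij.
  rewrite indicE memNset ?mulr0// => Qix; move/negP: ij; apply.
  apply/eqP/val_inj => /=; apply: (tQ i j I I); by exists x.
apply: (le_trans (lipschitz_norm x (p j) gL)).
by rewrite ler_wpM2l ?mulr_ge0// ltW// Qp.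
Qed.

End step_approximation.

(** * Cauchy property in L^1 along an ultrafilter *)

Section compactness.
Context {R : realType} {n : nat}.
Variable mu : {measure set 'rV[R]_n.+1 -> \bar R}.
Implicit Types (u v w : 'rV[R]_n.+1 -> R) (K : set 'rV[R]_n.+1) (a C D S : R).

(** Splitting the pairing requires the partial derivative to be measurable and bounded
    everywhere. *)
Lemma holder_test_sub a C D u v : mu.-integrable setT (EFin \o u) ->
  mu.-integrable setT (EFin \o v) ->
  holder_test a C (pairing mu u) -> holder_test a D (pairing mu v) ->
  holder_test a (C + D) (pairing mu (fun x => u x - v x)).
Proof.
move=> iu iv uC vD i F L B FL dF B0 FB.
have mDF := lipschitz_derive_measurable (delta_mx ord0 i) FL.
have [M DFM] := lipschitz_derive_bounded i FL.
rewrite (pairingBl iu iv mDF DFM) mulrDl (le_trans (ler_normB _ _))// lerD//.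
  exact: uC FL dF B0 FB.
exact: vD FL dF B0 FB.
Qed.

Lemma l1norm_holder_test a : 0 <= a < 1 -> exists2 k : R, 0 <= k &
  forall w D S eps, mu.-integrable setT (EFin \o w) ->
    holder_test a D (pairing mu w) -> 0 <= D -> 0 < S -> 0 < eps ->
  exists g, [/\ forall x, `|g x| <= 1, coord_lipschitz (2 / S) g &
    l1norm mu w <= `|pairing mu w g| + k * D * S `^ (1 - a) + eps].
Proof.
move=> a01; have [k k0 hk] := @holder_test_smoothing R n a a01.
exists k => // w D S eps iw wD D0 S0 eps0.
have [f [f1 [L fL] wf]] := lipschitz_dual iw eps0.
have [g [g1 gL gS]] := hk D _ _ f L S S0 D0 (pairing_l1_functional iw) wD fL f1.
exists g; split => //; apply: (le_trans wf); rewrite lerD2r.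
exact: le_trans (ler_norm _) gS.
Qed.

(** Four errors of [eps / 4]: duality, smoothing, oscillation on cells and integrals over cells. The
    choices follow in this order: [S] fixes the Lipschitz constant [2 / S], which fixes the mesh
    [delta], hence the number [N] of cells and the tolerance on each. The added 1 in the
    denominators keeps them positive. *)
Lemma ultra_l1_cauchy (T : Type) (G : set_system T) {GU : UltraFilter G}
    (u : T -> 'rV[R]_n.+1 -> R) K a M D eps :
  0 <= a < 1 -> compact K -> 0 <= M -> 0 <= D -> 0 < eps ->
  (forall k, mu.-integrable setT (EFin \o u k)) ->
  (forall k, l1norm mu (u k) <= M) ->
  (forall k x, ~ K x -> u k x = 0) ->
  (forall k, holder_test a D (pairing mu (u k))) ->
  exists2 A, G A &
    forall k l, A k -> A l -> l1norm mu (fun x => u k x - u l x) <= eps.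
Proof.
move=> a01 Kc M0 D0 eps0 iu uM uK uD.
have [c c0 hc] := l1norm_holder_test a01.
have a1 : 0 < 1 - a by rewrite subr_gt0; case/andP: a01.
have e4 : 0 < eps / 4 by rewrite divr_gt0.
pose r := eps / 4 / (c * (D + D) + 1).
have cD0 : 0 <= c * (D + D) by rewrite mulr_ge0// addr_ge0.
have r0 : 0 < r by rewrite divr_gt0// ltr_wpDl.
pose S := r `^ (1 - a)^-1.
have S0 : 0 < S by rewrite powR_gt0.
have Sr : S `^ (1 - a) = r by rewrite -powRrM mulVf ?gt_eqF// powRr1// ltW.
have cS : c * (D + D) * S `^ (1 - a) <= eps / 4.
  rewrite Sr /r mulrA ler_pdivrMr ?ltr_wpDl// mulrC ler_wpM2l ?(ltW e4)//.
  by rewrite lerDl.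
pose P := (M + M) * (n.+1%:R * (2 / S)).
have P0 : 0 <= P by rewrite !mulr_ge0 ?addr_ge0// invr_ge0 ltW.
pose delta := eps / 4 / (P + 1).
have delta0 : 0 < delta by rewrite divr_gt0// ltr_wpDl.
have Pdelta : P * delta <= eps / 4.
  rewrite /delta mulrA ler_pdivrMr ?ltr_wpDl// mulrC ler_wpM2l ?(ltW e4)//.
  by rewrite lerDl.
have [N [p [Q [mQ tQ KQ Qp]]]] := compact_partition Kc delta0.
have i1 j x : `|\1_(Q j) x : R| <= 1 by rewrite ger0_norm// indicE lern1 leq_b1.
have mi j : measurable_fun setT (\1_(Q j) : 'rV[R]_n.+1 -> R) by exact: measurable_indic.
have tM j k : `|pairing mu (u k) \1_(Q j)| <= M.
  apply: le_trans (uM k); rewrite -[leRHS]mulr1; exact: pairing_le.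
have eN : 0 < eps / 4 / N.+1%:R by rewrite divr_gt0.
have [A GA hA] := ultra_bounded_cauchy_seq (G := G) N tM eN.
exists A => // k l Ak Al.
set w := fun x => _.
have iw : mu.-integrable setT (EFin \o w) by exact: integrable_sub.
have wM : l1norm mu w <= M + M.
  apply: le_trans (lerD (uM k) (uM l)).
  rewrite /l1norm -RintegralD//; [|exact: (integrable_norm (iu k))|exact: (integrable_norm (iu l))].
  apply: le_Rintegral => //.
  - exact: (integrable_norm iw).
  - rewrite (_ : _ \o _ = (fun x => `|u k x|%:E + `|u l x|%:E)%E)//.
    by apply: integrableD => //; [exact: (integrable_norm (iu k))|exact: (integrable_norm (iu l))].
  - by move=> x _; exact: ler_normB.
have wK x : ~ K x -> w x = 0 by move=> Kx; rewrite /w !uK// subrr.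
have wD := holder_test_sub (iu k) (iu l) (uD k) (uD l).
have [g [g1 gL wg]] := hc w (D + D) S (eps / 4) iw wD (addr_ge0 D0 D0) S0 e4.
have mK := compact_measurable_rV Kc.
have := pairing_lipschitz_le (ltW delta0) iw mK wK gL g1 mQ tQ KQ Qp.
have s1 : l1norm mu w * (n.+1%:R * (2 / S) * delta) <= eps / 4.
  apply: le_trans Pdelta; rewrite /P -(mulrA (M + M)); apply: ler_wpM2r wM.
  by rewrite mulr_ge0 ?(ltW delta0)// mulr_ge0// divr_ge0// ltW.
have s2 : \sum_(j < N) `|pairing mu w \1_(Q j)| <= eps / 4.
  apply: (@le_trans _ _ (\sum_(j < N) (eps / 4 / N.+1%:R))).
    apply: ler_sum => j _; rewrite (pairingBl (iu k) (iu l) (mi j) (i1 j)).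
    exact: hA.
  rewrite sumr_const card_ord -[leLHS]mulr_natr -[leLHS]mulrA ler_piMr ?(ltW e4)//.
  by rewrite mulrC ler_pdivrMr// mul1r ler_nat.
move=> /le_trans/(_ (lerD s1 s2)) wg'.
by move: wg wg' cS; set X := c * _ * _; set Y := `|_|; lra.
Qed.

End compactness.

(** * Limits *)

Lemma limn_einf_ge0 {R : realType} (t : (\bar R)^nat) :
  (forall k, (0 <= t k)%E) -> (0 <= limn_einf t)%E.
Proof.
move=> t0; rewrite limn_einf_lim; apply: lime_ge; first exact: is_cvg_einfs.
by apply: nearW => k; apply: le_ereal_inf_tmp => _ [l _ <-].
Qed.

(** * Limits of fast Cauchy sequences in L^1 *)

Section l1_limit.
Context {d} {T : measurableType d} {R : realType} (mu : {measure set T -> \bar R}).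
Variable U : nat -> T -> R.
Hypothesis iU : forall k, mu.-integrable setT (EFin \o U k).
Hypothesis cU : forall k l, (k <= l)%N ->
  l1norm mu (fun x => U k x - U l x) <= 2^-1 ^+ k.

Let mU k : measurable_fun setT (U k).
Proof. by apply/measurable_EFinP; exact: measurable_int (iU k). Qed.

Let mUB k l : measurable_fun setT (fun x => `|U k x - U l x|%:E).
Proof.
by apply/measurable_EFinP; apply: measurableT_comp => //; exact: measurable_funB.
Qed.

(** The series of [|U k - U k.+1|] has integral at most 2, the sum of the powers of 1/2, so it is
    finite almost everywhere and the telescoping series converges absolutely there. *)
Let ae_cvg : {ae mu, forall x, cvgn (U ^~ x)}.
Proof.
pose S x := (\sum_(k <oo) `|U k x - U k.+1 x|%:E)%E.
have mS : measurable_fun setT S.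
  by apply: ge0_emeasurable_sum => // k x _ _; rewrite lee_fin.
have S_fin : mu.-integrable setT S.
  apply/integrableP; split => //.
  under eq_integral do rewrite gee0_abs ?nneseries_ge0//.
  rewrite integral_nneseries//.
  apply: (@le_lt_trans _ _ 2%:E); last exact: ltry.
  apply: lime_le; first by apply: is_cvg_nneseries => k _ _; exact: integral_ge0.
  near=> m.
  apply: (@le_trans _ _ (\sum_(0 <= k < m) (2^-1 ^+ k)%:E)%E).
    apply: lee_sum => k _; rewrite (integral_norm (integrable_sub (iU k) (iU k.+1))).
    by rewrite lee_fin cU.
  rewrite sumEFin lee_fin.
  have := @geometric_le_lim R m 1 2^-1 ler01; rewrite /series /= .
  under eq_bigr do rewrite mul1r.
  rewrite mul1r (_ : 1 - 2^-1 = 2^-1); last lra.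
  rewrite invrK; apply; rewrite ?ger0_norm//; lra.
have := integrable_ae measurableT S_fin; apply: filterS => x /(_ I) Sx.
have : cvgn [normed series (telescope (U ^~ x))].
  apply: nondecreasing_is_cvgn.
    by apply: nondecreasing_series => k _ _; exact: normr_ge0.
  exists (fine (S x)) => _ [m _ <-].
  rewrite -lee_fin fineK// /series/= -sumEFin.
  rewrite (eq_bigr (fun k => `|U k x - U k.+1 x|%:E)); last first.
    by move=> k _; rewrite /telescope /= distrC.
  exact: nneseries_lim_ge.
move=> /normed_cvg; rewrite telescopeK => h.
rewrite (_ : U ^~ x = (fun k => (U k x - U 0%N x) + cst (U 0%N x) k)); last first.
  by apply/funext => k; rewrite /cst subrK.
by apply: is_cvgD => //; exact: is_cvg_cst.
Unshelve. all: by end_near. Qed.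

Lemma l1_fast_cauchy_cvg : exists v, [/\ mu.-integrable setT (EFin \o v),
  forall k, l1norm mu (fun x => U k x - v x) <= 2^-1 ^+ k &
  forall x, (forall k, U k x = 0) -> v x = 0].
Proof.
(* Defined at every point, so that [v] vanishes exactly where all [U k] do and not merely almost
   everywhere on that set. *)
pose v x := fine (limn_esup (fun k => (U k x)%:E)).
have mv : measurable_fun setT v.
  apply: (measurableT_comp (fine_measurable measurableT)).
  by apply: measurable_fun_limn_esup => k; apply/measurable_EFinP.
have v_cvg : {ae mu, forall x, U k x @[k --> \oo] --> v x}.
  apply: filterS ae_cvg => x /cvg_ex[/= l Ul].
  rewrite /v (@cvg_limn_einf_sup _ _ l%:E _).2//.
  by apply: cvg_EFin => //; near=> k.
have mUv k : measurable_fun setT (fun x => `|U k x - v x|%:E).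
  by apply/measurable_EFinP; apply: measurableT_comp => //; exact: measurable_funB.
have Uv k : (\int[mu]_x `|U k x - v x|%:E <= (2^-1 ^+ k)%:E)%E.
  have mliminf : measurable_fun setT (fun x => limn_einf (fun l => `|U k x - U l x|%:E)%E).
    apply: measurableT_comp => //; apply: measurable_fun_limn_esup => l.
    exact: measurableT_comp.
  have -> : (\int[mu]_x `|U k x - v x|%:E =
      \int[mu]_x limn_einf (fun l => `|U k x - U l x|%:E))%E.
    apply: ge0_ae_eq_integral => //.
    - by move=> x _; apply: limn_einf_ge0.
    - apply: filterS v_cvg => x Ux _.
      rewrite (@cvg_limn_einf_sup _ _ `|U k x - v x|%:E _).1//.
      apply: cvg_EFin; first by near=> l.
      by apply: cvg_norm; apply: cvgB => //; exact: cvg_cst.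
  apply: le_trans (fatou _ measurableT (mUB k) _) _ => //.
  rewrite limn_einf_lim; apply: lime_le; first exact: is_cvg_einfs.
  (* The index [maxn m k] lies in the tail from [m] and is at least [k], as [cU] requires. *)
  apply: nearW => m; apply: (@le_trans _ _ (\int[mu]_x `|U k x - U (maxn m k) x|%:E)%E).
    by apply: ereal_inf_lbound; exists (maxn m k) => //=; exact: leq_maxl.
  rewrite (integral_norm (integrable_sub (iU k) (iU (maxn m k)))) lee_fin cU//.
  exact: leq_maxr.
have iUv k : mu.-integrable setT (EFin \o (fun x => U k x - v x)).
  apply/integrableP; split.
    by apply/measurable_EFinP; exact: measurable_funB.
  by apply: le_lt_trans (Uv k) _; exact: ltry.
exists v; split.
- rewrite (_ : v = fun x => U 0%N x - (U 0%N x - v x)); last first.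
    by apply/funext => x; rewrite subKr.
  exact: integrable_sub.
- by move=> k; rewrite -lee_fin -integral_norm.
- move=> x Ux; rewrite /v (@cvg_limn_einf_sup _ _ 0%E _).2//.
  by apply: cvg_near_cst; near=> k; rewrite Ux.
Unshelve. all: by end_near. Qed.

End l1_limit.

(** * Lower semicontinuity of the variation *)

Section lower_semicontinuity.
Context {R : realType} {n : nat}.
Implicit Types (f u v : 'rV[R]_n.+1 -> R) (g : 'I_n -> 'rV[R]_n.+1 -> R).

Local Notation mu := (@lebesgue_rV R n.+1).

Lemma half_pow_small (e : R) : 0 < e ->
  exists N : nat, forall k, (N <= k)%N -> 2^-1 ^+ k <= e.
Proof.
move=> e0; exists (Num.bound e^-1) => k Nk.
rewrite exprVn invf_ple ?posrE ?exprn_gt0//.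
apply: le_trans (ltW (archi_boundP _)) _; first by rewrite invr_ge0 ltW.
by rewrite -natrX ler_nat (leq_trans Nk)// ltnW// ltn_expl.
Qed.

Lemma Lip_coord_lipschitz f : (Lip f < +oo)%E -> coord_lipschitz (fine (Lip f)) f.
Proof.
move=> fL i x h; have [->|h0] := eqVneq h 0.
  by rewrite scale0r addr0 subrr !normr0 mulr0.
have Lfin : Lip f \is a fin_num by rewrite ge0_fin_numE// Lipa_ge0.
have eh : enorm (x + h *: delta_mx ord0 i - x) = `|h|.
  rewrite addrAC subrr add0r /enorm (bigD1 i)//= big1 ?addr0.
    by rewrite !mxE !eqxx mulr1 sqrtr_sqr.
  by move=> j ji; rewrite !mxE (negbTE ji) andbF mulr0 expr0n.
have xy : x + h *: delta_mx ord0 i != x.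
  rewrite -subr_eq0; apply: contra_neq h0 => xh0.
  apply/eqP; rewrite -normr_eq0 -eh xh0 /enorm big1 ?sqrtr0// => j _.
  by rewrite mxE expr0n.
rewrite -ler_pdivrMr ?normr_gt0// -lee_fin fineK//.
apply: ereal_sup_ubound; exists (x + h *: delta_mx ord0 i), x; split => //.
by rewrite eh powRr1.
Qed.

Let bounded_measurable f :=
  measurable_fun setT f /\ exists B, forall x, `|f x| <= B.

Let bounded_measurableM f f' : bounded_measurable f -> bounded_measurable f' ->
  bounded_measurable (fun x => f x * f' x).
Proof.
move=> [mf [B fB]] [mf' [B' f'B]]; split; first exact: measurable_funM.
by exists (B * B') => x; rewrite normrM ler_pM.
Qed.

Let bounded_measurableD f f' : bounded_measurable f -> bounded_measurable f' ->
  bounded_measurable (fun x => f x + f' x).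
Proof.
move=> [mf [B fB]] [mf' [B' f'B]]; split; first exact: measurable_funD.
by exists (B + B') => x; rewrite (le_trans (ler_normD _ _))// lerD.
Qed.

Let bounded_measurable_cst (c : R) : bounded_measurable (fun=> c).
Proof. by split; [exact: measurable_cst|exists `|c|]. Qed.

Let bounded_measurable_sum (I : Type) (r : seq I) (F : I -> 'rV[R]_n.+1 -> R) :
  (forall i, bounded_measurable (F i)) ->
  bounded_measurable (fun x => \sum_(i <- r) F i x).
Proof.
move=> hF; elim: r => [|i r IH].
  by rewrite (_ : (fun _ => _) = fun=> 0)//; apply/funext => x; rewrite big_nil.
rewrite (_ : (fun _ => _) = fun x => F i x + \sum_(i <- r) F i x); last first.
  by apply/funext => x; rewrite big_cons.
exact: bounded_measurableD.
Qed.

Let bounded_measurable_prod (I : Type) (r : seq I) (F : I -> 'rV[R]_n.+1 -> R) :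
  (forall i, bounded_measurable (F i)) ->
  bounded_measurable (fun x => \prod_(i <- r) F i x).
Proof.
move=> hF; elim: r => [|i r IH].
  by rewrite (_ : (fun _ => _) = fun=> 1)//; apply/funext => x; rewrite big_nil.
rewrite (_ : (fun _ => _) = fun x => F i x * \prod_(i <- r) F i x); last first.
  by apply/funext => x; rewrite big_cons.
exact: bounded_measurableM.
Qed.

(** The determinant is a polynomial in the partial derivatives, and bounded measurable functions
    form an algebra. *)
Lemma det_Dmx_bounded_measurable f g :
  (Lip f < +oo)%E -> (forall i, Lip (g i) < +oo)%E ->
  measurable_fun setT (fun x => \det (Dmx f g x)) /\
  exists B, forall x, `|\det (Dmx f g x)| <= B.
Proof.
move=> fL gL; rewrite -/(bounded_measurable _).
have entry i j : bounded_measurable (fun x => Dmx f g x i j).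
  have [h hL hE] : exists2 h, coord_lipschitz (fine (Lip h)) h &
      (fun x => Dmx f g x i j) = 'D_(delta_mx ord0 j) h.
    exists (if unlift ord0 i is Some k then g k else f); last first.
      by apply/funext => x; rewrite mxE.
    by case: unlift => [k|]; exact: Lip_coord_lipschitz.
  rewrite hE; split; first exact: lipschitz_derive_measurable hL.
  exact: lipschitz_derive_bounded hL.
apply: bounded_measurable_sum => s; apply: bounded_measurableM => //.
exact: bounded_measurable_prod.
Qed.

Lemma Valpha_ge0 a u : (0 <= Valpha a u)%E.
Proof. by apply: le_ereal_inf_tmp => C []. Qed.

(** Serves to pass from [u] to its truncation by the indicator of [K]. *)
Lemma Valpha_ae_le a u v : measurable_fun setT u -> measurable_fun setT v ->
  {ae mu, forall x, u x = v x} -> (Valpha a u <= Valpha a v)%E.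
Proof.
move=> mU mv uv; apply: ereal_inf_le_tmp => C [C0 hC]; split => // f g fL gL.
have [mJ _] := det_Dmx_bounded_measurable fL gL.
rewrite (ae_eq_integral (fun x => (v x * \det (Dmx f g x))%:E))//.
- exact: hC.
- by apply/measurable_EFinP; exact: measurable_funM.
- by apply/measurable_EFinP; exact: measurable_funM.
- by apply: filterS uv => x uvx _; rewrite uvx.
Qed.

(** For fixed [f] and [g] the Jacobian is bounded and measurable, so the tested integral is
    continuous in L^1 and every bound [l + e] passes to the limit. *)
Lemma Valpha_lsc a (U : nat -> 'rV[R]_n.+1 -> R) v (l : R) :
  (forall k, mu.-integrable setT (EFin \o U k)) -> mu.-integrable setT (EFin \o v) ->
  (forall k, l1norm mu (fun x => U k x - v x) <= 2^-1 ^+ k) ->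
  (forall k, Valpha a (U k) < (l + 2^-1 ^+ k)%:E)%E ->
  (Valpha a v <= l%:E)%E.
Proof.
move=> iU iv Uv UV; apply/lee_addgt0Pr => e e0.
have [N hN] := half_pow_small e0.
have Vlt k : (N <= k)%N -> (Valpha a (U k) < (l + e)%:E)%E.
  by move=> Nk; apply: lt_le_trans (UV k) _; rewrite lee_fin lerD2l hN.
rewrite -EFinD; apply: ereal_inf_lbound; split.
  exact: le_trans (Valpha_ge0 a (U N)) (ltW (Vlt N (leqnn N))).
move=> f g fL gL.
have [mJ [B JB]] := det_Dmx_bounded_measurable fL gL.
set J := fun x => _ in mJ JB.
(* This may be infinite, since [Lipa a f] may be; the comparisons therefore stay in the extended
   reals. *)
set rhs := (_ * _)%E.
have rhsE k : (N <= k)%N -> (`|pairing mu (U k) J|%:E <= rhs)%E.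
  move=> Nk; rewrite /pairing EFin_normr_Rintegral//; last exact: integrable_mul_bounded JB.
  have /ereal_inf_lt[C [C0 hC] Cl] := Vlt k Nk.
  apply: le_trans (hC f g fL gL) _.
  apply: lee_wpmul2r; first by apply: prode_ge0 => i _; exact: Lipa_ge0.
  by apply: lee_wpmul2r; [exact: Lipa_ge0|exact: ltW].
rewrite -EFin_normr_Rintegral//; last exact: integrable_mul_bounded JB.
rewrite -/(pairing mu v J); apply/lee_addgt0Pr => d d0.
have [N' hN'] : exists N', forall k, (N' <= k)%N -> 2^-1 ^+ k <= d / (B + 1).
  apply: half_pow_small; rewrite divr_gt0// ltr_wpDl//.
  exact: le_trans (JB 0).
pose k := maxn N N'.
have B0 : 0 <= B by exact: le_trans (JB 0).
apply: (@le_trans _ _ (`|pairing mu (U k) J|%:E + d%:E)%E); last first.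
  by apply: leeD => //; apply: rhsE; exact: leq_maxl.
rewrite -EFinD lee_fin -lerBlDl.
rewrite (le_trans (lerB_dist _ _))// distrC -(pairingBl (iU k) iv mJ JB).
rewrite (le_trans (pairing_le _ mJ JB))//; first exact: integrable_sub.
have := le_trans (Uv k) (hN' k (leq_maxr _ _)).
rewrite ler_pdivlMr ?ltr_wpDl// => h; apply: le_trans h.
by rewrite ler_wpM2l// ?lerDl// l1norm_ge0.
Qed.

End lower_semicontinuity.

(** * Conclusion *)

(** Guarantees that the base sets of the filter in the final proof are nonempty. *)
Lemma limn_einf_frequently {R : realType} (t : (\bar R)^nat) (l : R) (e : R) (N : nat) :
  limn_einf t = l%:E -> 0 < e -> exists2 k, (N <= k)%N & (t k < (l + e)%:E)%E.
Proof.
move=> tl e0; have : (einfs t N < (l + e)%:E)%E.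
  apply: (@le_lt_trans _ _ l%:E); last by rewrite lte_fin ltrDl.
  rewrite -tl limn_einf_lim; apply: lime_ge; first exact: is_cvg_einfs.
  by near=> k; apply: nondecreasing_einfs; near: k; exact: nbhs_infty_ge.
by move=> /ereal_inf_lt[_ [k /= Nk <-]] tk; exists k.
Unshelve. all: by end_near. Qed.

(** The term [phi j] is chosen in the intersection of [A 0] to [A j], a member of [G], beyond the
    previous term. *)
Lemma ultra_subsequence (G : set_system nat) {GU : UltraFilter G} (A : nat -> set nat) :
  (forall m, G (A m)) -> (forall N, G [set k | (N <= k)%N]) ->
  exists phi : nat -> nat, {homo phi : i j / (i < j)%N >-> (i < j)%N} /\
    forall i j, (i <= j)%N -> A i (phi j).
Proof.
move=> GA GN.
have GI m : G (\bigcap_(i < m) A i).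
  elim: m => [|m IH]; first by rewrite bigcap_mkord big_ord0; exact: filterT.
  rewrite bigcap_mkord big_ord_recr /= -bigcap_mkord; exact: filterI.
have next (q : nat * nat) : {k | (q.2 < k)%N /\ (\bigcap_(i < q.1.+1) A i) k}.
  apply: cid; have [k [k1 k2]] := filter_ex (filterI (GN q.2.+1) (GI q.1.+1)).
  by exists k.
pose fix phi m := if m is m'.+1 then sval (next (m, phi m')) else sval (next (0, 0)%N).
exists phi; split.
  apply: homo_ltn => [y x z|m]; first exact: ltn_trans.
  by have [] := svalP (next (m.+1, phi m)).
move=> i j ij; have : (\bigcap_(i < j.+1) A i) (phi j).
  by case: j {ij} => [|j]; [have [] := svalP (next (0, 0)%N)|have [] := svalP (next (j.+1, phi j))].
by apply; rewrite /= ltnS.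
Qed.

Lemma ae_zero_off_spt {R : realType} {n : nat} (u : 'rV[R]_n.+1 -> R) :
  {ae (@lebesgue_rV R n.+1), forall x, ~ spt u x -> u x = 0}.
Proof.
have := @ae_bigcup_open R n.+1 (@lebesgue_rV R n.+1) (fun x => u x = 0)
  [set U | open U /\ {ae (@lebesgue_rV R n.+1), forall x, U x -> u x = 0}].
move=> /(_ (fun U h => h)); apply: filterS => x h nx; apply: h.
by apply: contrapT.
Qed.

Lemma spt_sub {R : realType} {n : nat} (u : 'rV[R]_n.+1 -> R) K :
  closed K -> (forall x, ~ K x -> u x = 0) -> spt u `<=` K.
Proof.
move=> Kc uK x ux; apply: contrapT => nKx; apply: ux; exists (~` K) => //.
by split; [exact: closed_openC|exact: aeW].
Qed.

Lemma spt_closed {R : realType} {n : nat} (u : 'rV[R]_n.+1 -> R) : closed (spt u).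
Proof. by apply: open_closedC; apply: bigcup_open => U []. Qed.

Lemma l1norm_ae_eq {d} {T : measurableType d} {R : realType}
    (mu : {measure set T -> \bar R}) (u v : T -> R) :
  measurable_fun setT u -> measurable_fun setT v ->
  {ae mu, forall x, u x = v x} -> l1norm mu u = l1norm mu v.
Proof.
move=> mU mV uv; rewrite /l1norm /Rintegral; congr fine.
apply: ae_eq_integral => //.
- by apply/measurable_EFinP; exact: measurableT_comp.
- by apply/measurable_EFinP; exact: measurableT_comp.
- by apply: filterS uv => x -> _.
Qed.

Lemma L1norm_l1norm {R : realType} {n : nat} (u : 'rV[R]_n.+1 -> R) :
  (@lebesgue_rV R n.+1).-integrable setT (EFin \o u) ->
  L1norm u = (l1norm (@lebesgue_rV R n.+1) u)%:E.
Proof. by move=> iu; rewrite /L1norm Lnorm1 -integral_norm. Qed.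

Theorem proposition3p4 (R : realType) (n : nat) (a : R) (ha : 0 <= a < 1)
    (u : nat -> 'rV[R]_n.+1 -> R) (K : set 'rV[R]_n.+1)
    (hu : forall k, BVc a (u k))
    (hsup : (ereal_sup (range (fun k => L1norm (u k) + Valpha a (u k))) < +oo)%E)
    (hK : compact K)
    (hspt : \bigcup_k spt (u k) `<=` K) :
  exists (phi : nat -> nat) (v : 'rV[R]_n.+1 -> R),
    [/\ {homo phi : i j / (i < j)%N >-> (i < j)%N},
        BVc a v,
        L1norm (u (phi k) \- v) @[k --> \oo] --> 0%E
      & (Valpha a v <= limn_einf (fun k => Valpha a (u k)))%E].
Proof.
pose mu := @lebesgue_rV R n.+1.
have iu k : mu.-integrable setT (EFin \o u k) by have [[]] := hu k.
have mf w : mu.-integrable setT (EFin \o w) -> measurable_fun setT w.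
  by move=> iw; apply/measurable_EFinP; exact: measurable_int iw.
have mK := compact_measurable_rV hK.
have Kc : closed K by apply: compact_closed hK; exact: norm_hausdorff.
(* Off [K] the function [u k] vanishes only almost everywhere; the truncation vanishes at every
   point. *)
pose uK k x := u k x * \1_K x.
have iuK k : mu.-integrable setT (EFin \o uK k).
  have mi : measurable_fun setT (\1_K : 'rV[R]_n.+1 -> R) by exact: measurable_indic.
  apply: (integrable_mul_bounded (iu k) mi (B := 1)) => x.
  by rewrite ger0_norm// indicE lern1 leq_b1.
have uK0 k x : ~ K x -> uK k x = 0.
  by move=> nKx; rewrite /uK indicE memNset ?mulr0.
have uKu k : {ae mu, forall x, uK k x = u k x}.
  apply: filterS (ae_zero_off_spt (u k)) => x ux; rewrite /uK indicE.
  have [Kx|nKx] := pselect (K x); first by rewrite mem_set// mulr1.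
  rewrite memNset// mulr0 ux// => sx; apply: nKx.
  by apply: hspt; exists k.
have VuK k : (Valpha a (uK k) <= Valpha a (u k))%E.
  by apply: Valpha_ae_le => //; exact: mf.
pose s := ereal_sup (range (fun k => L1norm (u k) + Valpha a (u k)))%E.
have LVs k : (L1norm (u k) + Valpha a (u k) <= s)%E.
  by apply: ereal_sup_ubound; exists k.
have L0 k : (0 <= L1norm (u k))%E by rewrite L1norm_l1norm// lee_fin l1norm_ge0.
have s0 : (0 <= s)%E.
  by apply: le_trans (LVs 0%N); rewrite adde_ge0// Valpha_ge0.
pose M := fine s.
have sM : s = M%:E by rewrite fineK// ge0_fin_numE.
have M0 : 0 <= M by rewrite fine_ge0.
have LM k : l1norm mu (uK k) <= M.
  rewrite (l1norm_ae_eq (mf _ (iuK k)) (mf _ (iu k)) (uKu k)) -lee_fin -sM.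
  rewrite -L1norm_l1norm//; apply: le_trans (LVs k).
  by rewrite leeDl// Valpha_ge0.
have VM k : (Valpha a (u k) <= M%:E)%E.
  by rewrite -sM; apply: le_trans (LVs k); rewrite leeDr.
(* The bound is [M + 1] because [Valpha_holder_test] asks for a strict inequality. *)
have uKD k : holder_test a (M + 1) (pairing mu (uK k)).
  apply: Valpha_holder_test; apply: le_lt_trans (VuK k) _.
  by apply: le_lt_trans (VM k) _; rewrite lte_fin ltrDl.
set lV := limn_einf _.
have lV0 : (0 <= lV)%E by apply: limn_einf_ge0 => k; exact: Valpha_ge0.
have lVM : (lV <= M%:E)%E.
  rewrite /lV limn_einf_lim; apply: lime_le; first exact: is_cvg_einfs.
  apply: nearW => k; apply: le_trans (VM k).
  by apply: ereal_inf_lbound; exists k => /=.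
have lVE : lV = (fine lV)%:E.
  by rewrite fineK// ge0_fin_numE// (le_lt_trans lVM)// ltry.
(* These sets decrease with [N]. The condition [N <= k] lets the extracted indices increase; the
   other one compares the limit with the lower limit of the whole sequence and not just of the
   subsequence. *)
pose B N := [set k | (N <= k)%N /\ (Valpha a (u k) < (fine lV + 2^-1 ^+ N)%:E)%E].
have half0 N : 0 < 2^-1 ^+ N :> R by rewrite exprn_gt0// invr_gt0.
have FB : ProperFilter (filter_from [set: nat] B).
  apply: filter_from_proper => [|N _].
    apply: filter_from_filter => [|N N' _ _]; first by exists 0%N.
    exists (maxn N N') => // k [Nk Vk]; split; split.
    - exact: leq_trans (leq_maxl _ _) Nk.
    - apply: (lt_le_trans Vk); rewrite lee_fin lerD2l.
      by rewrite ler_wiXn2l ?leq_maxl// ?invr_ge0// invf_le1// ler1n.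
    - exact: leq_trans (leq_maxr _ _) Nk.
    - apply: (lt_le_trans Vk); rewrite lee_fin lerD2l.
      by rewrite ler_wiXn2l ?leq_maxr// ?invr_ge0// invf_le1// ler1n.
  by have [k Nk Vk] := limn_einf_frequently N lVE (half0 N); exists k.
have [G [GU FG]] := ultraFilterLemma FB.
have GB N : G (B N) by apply: FG; exists N.
have GN N : G [set k | (N <= k)%N] by apply: filterS (GB N) => k [].
have hA N : exists A, G A /\ forall k l, A k -> A l ->
    l1norm mu (fun x => uK k x - uK l x) <= 2^-1 ^+ N.
  have [A GA hA] := ultra_l1_cauchy (G := G) ha hK M0 (addr_ge0 M0 ler01) (half0 N) iuK LM uK0 uKD.
  by exists A.
have [A hAA] := choice hA.
have [phi [phi_homo phiAB]] := ultra_subsequence (A := fun N => A N `&` B N)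
  (fun N => filterI (hAA N).1 (GB N)) GN.
have cU k l : (k <= l)%N -> l1norm mu (fun x => uK (phi k) x - uK (phi l) x) <= 2^-1 ^+ k.
  by move=> kl; apply: (hAA k).2; [have [] := phiAB k k (leqnn k)|have [] := phiAB k l kl].
have [v [iv Uv v0]] := l1_fast_cauchy_cvg (fun k => iuK (phi k)) cU.
have v_off_K x : ~ K x -> v x = 0 by move=> nKx; apply: v0 => k; exact: uK0.
have Vv : (Valpha a v <= lV)%E.
  rewrite lVE; apply: (Valpha_lsc (fun k => iuK (phi k)) iv Uv) => k.
  by apply: le_lt_trans (VuK _) _; have [_ []] := phiAB k k (leqnn k).
exists phi, v; split => //.
- split; last by apply: le_lt_trans Vv _; rewrite lVE ltry.
  split => //; apply: subclosed_compact hK _; first exact: spt_closed.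
  exact: spt_sub.
- have iuv k : mu.-integrable setT (EFin \o (u (phi k) \- v)).
    exact: integrable_sub.
  (* The convergence obtained for the truncations is carried back to the original functions, which
     agree with them almost everywhere. *)
  have E k : L1norm (u (phi k) \- v) = (l1norm mu (fun x => uK (phi k) x - v x))%:E.
    rewrite L1norm_l1norm//; congr EFin; apply: l1norm_ae_eq.
    - exact: mf.
    - by apply: mf; exact: integrable_sub.
    - by apply: filterS (uKu (phi k)) => x /= ->.
  rewrite (funext E); apply: cvg_EFin; first exact: nearW.
  apply: (@squeeze_cvgr _ _ _ _ (fun=> 0) (fun k => 2^-1 ^+ k)).
  + by apply: nearW => k; rewrite l1norm_ge0 Uv.
  + exact: cvg_cst.
  + rewrite (_ : (fun k => _) = geometric 1 2^-1); last first.
      by apply/funext => k; rewrite /geometric /= mul1r.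
    apply: cvg_geometric; rewrite ger0_norm//; lra.
Qed.
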